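(* Let $\alpha>0$, $M>0$, and let $U,T$ be the base-flow profiles described in the context. Let $c_0\in\mathbb{C}$ be a trapped rigid-wall eigenvalue, i.e. $D(c_0,0)=P'(0;c_0)=0$ with $\operatorname{Re}\gamma(c_0)>0$, which is simple in the sense that $D_c(c_0,0)\neq 0$. Assume that a neighbourhood of $c_0$ contains no sonic branch points (zeros of $1-M^2(1-c)^2$) and no $c$ producing a critical singularity on the real $y$-axis; if a critical point is present, the causal indentation described in the context is used. Let $\hat p_0$ be a corresponding rigid-wall eigenfunction (any nonzero multiple of $P(\cdot;c_0)$), so that $\hat p_0'(0)=0$. Let the wall condition be perturbed to $$\hat p'(0)=-\frac{i\alpha c A}{T_w}\,\hat p(0),\qquad A\in\mathbb{C}.$$ Then for all sufficiently small $|A|$ the eigenvalue branch $c(A)$ with $c(0)=c_0$ (the unique analytic solution near $c_0$ of $D(c(A),A)=0$) satisfies $$c(A)=c_0+KA+\mathcal O(|A|^2),\qquad K=\frac{i\alpha\,\hat p_0(0)^2}{c_0\,I},$$ where, with $\gamma_0=\gamma(c_0)$, $$I=\int_0^{y_b}\frac{2T}{(U-c_0)^3}\Big(\hat p_0'^{\,2}+\alpha^2\hat p_0^{\,2}\Big)\,dy+I_\infty,\qquad I_\infty=\frac{2}{(1-c_0)^3}\,\frac{(\gamma_0^2+\alpha^2)\,\hat p_0(y_b)^2}{2\gamma_0}.$$ Consequently the growth rate $\sigma(A)=\alpha\operatorname{Im}c(A)$ satisfies $$\delta\sigma:=\sigma(A)-\sigma(0)=\alpha\operatorname{Im}(KA)+\mathcal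 O(|A|^2).$$
   Context: Base flow: $U,T:[0,\infty)\to\mathbb{R}$ are smooth on $[0,y_b]$, $T>0$, $U(0)=0$, $T_w:=T(0)$, and $U=T=1$ for $y\ge y_b$ (uniform stream), for some $y_b>0$. The wavenumber $\alpha$ is real and positive, $M$ is the Mach number. Compressible Rayleigh equation for the pressure $\hat p(y)$ with complex phase speed $c$: $$\hat p''-\left(\frac{2U'}{U-c}-\frac{T'}{T}\right)\hat p'-\alpha^2\left(1-\frac{M^2(U-c)^2}{T}\right)\hat p=0,$$ equivalently $(\Phi\hat p')'=\alpha^2(\Phi-M^2)\hat p$ with $\Phi(y;c)=T/(U-c)^2$. Far-field condition: $\hat p(y)=\hat p(y_b)\,e^{-\gamma(c)(y-y_b)}$ for $y\ge y_b$, where $\gamma(c)=\alpha[1-M^2(1-c)^2]^{1/2}$, the analytic branch near $c_0$ with $\operatorname{Re}\gamma(c_0)>0$ (''trapped''). Dispersion function: let $P(y;c)$ solve the Rayleigh equation on $[0,y_b]$ with $P(y_b;c)=1$, $P'(y_b;c)=-\gamma(c)$ (prime $=d/dy$), and $$D(c,A)=P'(0;c)+\frac{i\alpha cA}{T_w}P(0;c).$$ The eigenvalues of the problem with wall admittance $A$ are the zeros $c$ of $D(\cdot,A)$; $A=0$ is the rigid wall. Critical points: absence of critical singularities means $U(y)\neq c$ for $y\in[0,y_b]$ and $c$ near $c_0$. If a critical point $U(y_c)=c_0$ lies on the real axis, $U,T$ are continued analytically near $y_c$, and the interval $[0,y_b]$ is replaced, in the differential equation and in the integral defining $I$, by a path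 from $0$ to $y_b$ in the complex $y$-plane indented around $y_c$ on the side obtained by continuing from $\operatorname{Im}c>0$ (so that $U\neq c$ on the path for $c$ near $c_0$). Convention: $A$ is a complex parameter. For a wall law $A=\varepsilon\mathcal A(\alpha,c)$ with $\mathcal A$ analytic in $c$ near $c_0$, $A$ in the expansion means $\varepsilon\mathcal A(\alpha,c_0)$, the $c$-dependence contributing only at order $\varepsilon^2$. *)

(* Defs.v *)
From Stdlib Require Export Reals.
From Coquelicot Require Export Coquelicot.

Definition segment (a b x : R) : Prop := (a <= x <= b)%R.

(* One-sided derivatives at the endpoints [a] and [b]. *)
Definition is_derive_on (a b : R) (f df : R -> C) : Prop :=
  forall x : R, segment a b x ->
    @filterdiff R_AbsRing R_NormedModule C_R_NormedModule
      f (within (segment a b) (locally x)) (fun h : R => scal h (df x)).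

Definition smooth_on (a b : R) (f : R -> R) : Prop :=
  exists g : R -> R,
    (forall (n : nat) (x : R), ex_derive_n g n x) /\
    (forall x : R, segment a b x -> f x = g x).

Definition in_disc (z0 : C) (r : R) (z : C) : Prop := (Cmod (z - z0) < r)%R.

Definition analytic_on (f : C -> C) (D : C -> Prop) : Prop :=
  forall z : C, D z -> @ex_derive C_AbsRing C_NormedModule f z.

Record base_flow (yb : R) (U T : R -> R) : Prop := {
  bf_yb : (0 < yb)%R;
  bf_smoothU : smooth_on 0 yb U;
  bf_smoothT : smooth_on 0 yb T;
  bf_Tpos : forall y : R, (0 <= y)%R -> (0 < T y)%R;
  bf_noslip : U 0%R = 0%R;
  bf_stream : forall y : R, (yb <= y)%R -> U y = 1%R /\ T y = 1%R }.

Definition critical (yb : R) (U : R -> R) (c0 : C) (y : R) : Prop :=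
  segment 0 yb y /\ RtoC (U y) = c0.

(* The region, made of discs around the critical points, to which the base
   flow is continued; it is empty when there is no critical point. *)
Definition near_critical (yb : R) (U : R -> R) (c0 : C) (rho : R) (z : C) : Prop :=
  exists yc : R, critical yb U c0 yc /\ in_disc (RtoC yc) rho z.

Definition on_real_segment (yb : R) (z : C) : Prop :=
  exists y : R, segment 0 yb y /\ z = RtoC y.

(* The base flow and its y-derivatives, as functions of complex y. *)
Record profile := {
  pU : C -> C;
  pdU : C -> C;
  pT : C -> C;
  pdT : C -> C }.

Record is_continuation (yb : R) (U T : R -> R) (c0 : C) (rho : R)
    (F : profile) : Prop := {
  ic_U : forall y : R, segment 0 yb y -> pU F (RtoC y) = RtoC (U y);
  ic_T : forall y : R, segment 0 yb y -> pT F (RtoC y) = RtoC (T y);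
  ic_dU : is_derive_on 0 yb (fun y => pU F (RtoC y)) (fun y => pdU F (RtoC y));
  ic_dT : is_derive_on 0 yb (fun y => pT F (RtoC y)) (fun y => pdT F (RtoC y));
  ic_holoU : forall z : C, near_critical yb U c0 rho z ->
    @is_derive C_AbsRing C_NormedModule (pU F) z (pdU F z);
  ic_holoT : forall z : C, near_critical yb U c0 rho z ->
    @is_derive C_AbsRing C_NormedModule (pT F) z (pdT F z);
  ic_Tneq0 : forall z : C, near_critical yb U c0 rho z -> pT F z <> 0%C }.

(* A path s |-> y in the complex y-plane, 0 <= s <= yb, with dy/ds. *)
Record path := {
  py : R -> C;
  pdy : R -> C }.

(* The path is C^1 in s, and its speed may vanish: a corner of a piecewise C^1
   path is passed at zero speed.
   [cc_causal] states on which side the path passes the critical points: it is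
   deformed from the real segment without crossing any zero of U - c, for c
   near c0 with Im c > 0. *)
Record causal_path (yb : R) (U : R -> R) (c0 : C) (r rho : R)
    (F : profile) (L : path) : Prop := {
  cc_start : py L 0%R = 0%C;
  cc_end : py L yb = RtoC yb;
  cc_derive : is_derive_on 0 yb (py L) (pdy L);
  cc_C1 : continuous_on (segment 0 yb) (pdy L);
  (* off the region of continuation, the path stays on the real axis *)
  cc_region : forall s : R, segment 0 yb s ->
    near_critical yb U c0 rho (py L s) \/
    within (segment 0 yb) (locally s) (fun s' => on_real_segment yb (py L s'));
  cc_noncritical : forall s c, segment 0 yb s -> in_disc c0 r c ->
    pU F (py L s) <> c;
  cc_straight : (forall y : R, ~ critical yb U c0 y) ->
    forall s : R, segment 0 yb s -> py L s = RtoC s;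
  cc_causal : exists H : R * R -> C,
    continuous_on (fun x => segment 0 1 (fst x) /\ segment 0 yb (snd x)) H /\
    (forall s, segment 0 yb s -> H (0%R, s) = RtoC s /\ H (1%R, s) = py L s) /\
    (forall t, segment 0 1 t -> H (t, 0%R) = 0%C /\ H (t, yb) = RtoC yb) /\
    (forall t s, segment 0 1 t -> segment 0 yb s ->
       (on_real_segment yb (H (t, s)) \/ near_critical yb U c0 rho (H (t, s))) /\
       (forall c, in_disc c0 r c -> (0 < Im c)%R -> pU F (H (t, s)) <> c)) }.

(* [p] and [dp] are the pressure and its y-derivative as functions of the path
   parameter, whence the factors dy/ds. *)
Definition rayleigh_solution (alpha M yb : R) (F : profile) (L : path) (c : C)
    (p dp : R -> C) : Prop :=
  is_derive_on 0 yb p (fun s => (dp s * pdy L s)%C) /\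
  is_derive_on 0 yb dp (fun s =>
    let y := py L s in
    (((RtoC 2 * pdU F y / (pU F y - c) - pdT F y / pT F y) * dp s
      + RtoC alpha ^ 2 * (1 - RtoC M ^ 2 * (pU F y - c) ^ 2 / pT F y) * p s)
     * pdy L s)%C).

Definition gamma_branch (alpha M : R) (c0 : C) (r : R) (gamma : C -> C) : Prop :=
  analytic_on gamma (in_disc c0 r) /\
  (forall c : C, in_disc c0 r c ->
     (gamma c ^ 2 = RtoC alpha ^ 2 * (1 - RtoC M ^ 2 * (1 - c) ^ 2))%C) /\
  (0 < Re (gamma c0))%R.

Definition dispersion (alpha Tw : R) (P dP : C -> R -> C) (c A : C) : C :=
  (dP c 0%R + Ci * RtoC alpha * c * A / RtoC Tw * P c 0%R)%C.

Definition norm_integral (alpha yb : R) (F : profile) (L : path) (c0 gamma0 : C)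
    (p dp : R -> C) : C :=
  (RInt (V := C_R_CompleteNormedModule)
     (fun s => let y := py L s in
        RtoC 2 * pT F y / (pU F y - c0) ^ 3
        * (dp s ^ 2 + RtoC alpha ^ 2 * p s ^ 2) * pdy L s)%C 0 yb
   + RtoC 2 / (1 - c0) ^ 3
     * ((gamma0 ^ 2 + RtoC alpha ^ 2) * p yb ^ 2 / (RtoC 2 * gamma0)))%C.

Definition sensitivity (alpha yb : R) (F : profile) (L : path) (c0 gamma0 : C)
    (p dp : R -> C) : C :=
  (Ci * RtoC alpha * p 0%R ^ 2
   / (c0 * norm_integral alpha yb F L c0 gamma0 p dp))%C.

Definition growth_rate (alpha : R) (c : C) : R := (alpha * Im c)%R.

(* Main.v *)
(* Along the path, p and q = T p' / (U - c)^2 solve a linear system whose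
   coefficients are Lipschitz in c, and the wall condition with admittance A
   reads A = G(c), where G(c) = i c q(0) / (alpha p(0)). Let p1, p2 be the
   solutions for c = c1, c2. Their Wronskian q2 p1 - q1 p2 has the derivative
   T (1/(U - c2)^2 - 1/(U - c1)^2) (p1' p2' + alpha^2 p1 p2); integrating it gives
   G(c2) - G(c1) = (c2 - c1) H(c1, c2) with an explicit H, which is Lipschitz by
   Gronwall's inequality. So G is invertible near c0, the expansion of its inverse
   has a remainder O(|A|^2), and K = 1 / H(c0, c0). The divided difference H makes
   it unnecessary to differentiate the solutions in c or to know that the
   derivatives of holomorphic functions are continuous. *)

Require Import Defs.
From Stdlib Require Import Lra ClassicalEpsilon.
Open Scope R_scope.

(** * Curves in the complex plane *)

(** The family P(.;c) is given as one solution for each c, with no regularity in c. Regularity is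
    inherited from the data at y_b, which are 1 and -gamma(c)/(1 - c)^2 in the unknowns p, q. Here
    gamma is Lipschitz because gamma^2 is a polynomial in c: gamma(c2) - gamma(c1) is c2 - c1 times
    a polynomial, divided by gamma(c1) + gamma(c2), and this sum stays away from 0 near c0 since
    gamma(c0) is not 0. The same quotient allows the boundary term of the Wronskian to be divided by
    c2 - c1, and it is the source of I_infty. Three facts make G usable: c is not 0 on the disc,
    since U(0) = 0 is not critical; p(0) is not 0 near c0, since p(0) = p'(0) = 0 would force p(y_b)
    = 0; and H(c0, c0) is not 0, since otherwise G(c) = O(|c - c0|^2) and D(., 0) would have
    derivative 0 at c0, against simplicity. Along the indented path everything is a function of the
    real parameter s, with a factor dy/ds, so real-variable calculus suffices. *)

Definition curve_derive (f : R -> C) (x : R) (l : C) : Prop :=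
  @is_derive R_AbsRing C_R_NormedModule f x l.

Lemma curve_derive_components (f : R -> C) x l :
  curve_derive f x l <->
  is_derive (fun t => Re (f t)) x (Re l) /\ is_derive (fun t => Im (f t)) x (Im l).
Proof.
  split.
  - intros H; split.
    + apply (filterdiff_comp' (U := R_NormedModule) (V := C_R_NormedModule) (W := R_NormedModule)
        f Re x _ (@fst R R) H).
      apply filterdiff_linear, is_linear_fst.
    + apply (filterdiff_comp' (U := R_NormedModule) (V := C_R_NormedModule) (W := R_NormedModule)
        f Im x _ (@snd R R) H).
      apply filterdiff_linear, is_linear_snd.
  - intros [H1 H2].
    apply (filterdiff_ext (U := R_NormedModule) (V := C_R_NormedModule)
             (fun t => (Re (f t), Im (f t)))).
    { intros y. now destruct (f y). }
    apply (filterdiff_comp'_2 (T := R_NormedModule) (U := R_NormedModule) (V := R_NormedModule)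
             (W := C_R_NormedModule)
             (fun t => Re (f t)) (fun t => Im (f t)) (fun a b => (a, b) : C) x
             _ _ (fun a b => (a, b) : C) H1 H2).
    apply (filterdiff_ext (U := C_R_NormedModule) (V := C_R_NormedModule) (fun t => t)).
    { intros [a b]; reflexivity. }
    apply (filterdiff_ext_lin (U := C_R_NormedModule) (V := C_R_NormedModule)) with (fun t => t).
    + apply filterdiff_id.
    + intros [a b]; reflexivity.
Qed.

Lemma curve_derive_eq f x l l' : curve_derive f x l -> l = l' -> curve_derive f x l'.
Proof. now intros H <-. Qed.

Lemma curve_derive_minus (f g : R -> C) x lf lg :
  curve_derive f x lf -> curve_derive g x lg ->
  curve_derive (fun t => f t - g t)%C x (lf - lg)%C.
Proof. apply (@is_derive_minus R_AbsRing C_R_NormedModule). Qed.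

Lemma curve_derive_const a x : curve_derive (fun _ => a) x 0%C.
Proof. apply (@is_derive_const R_AbsRing C_R_NormedModule). Qed.

Lemma curve_derive_mult (f g : R -> C) x lf lg :
  curve_derive f x lf -> curve_derive g x lg ->
  curve_derive (fun t => f t * g t)%C x (lf * g x + f x * lg)%C.
Proof.
  rewrite !curve_derive_components. intros [Hf1 Hf2] [Hg1 Hg2]. split.
  - apply (is_derive_ext (fun t => Re (f t) * Re (g t) - Im (f t) * Im (g t))).
    { reflexivity. }
    evar_last.
    + apply (@is_derive_minus R_AbsRing R_NormedModule);
        apply (@is_derive_mult R_AbsRing); try eassumption; intros; apply Rmult_comm.
    + unfold minus, plus, opp, mult, Re, Im; simpl. ring.
  - apply (is_derive_ext (fun t => Re (f t) * Im (g t) + Im (f t) * Re (g t))).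
    { reflexivity. }
    evar_last.
    + apply (@is_derive_plus R_AbsRing R_NormedModule);
        apply (@is_derive_mult R_AbsRing); try eassumption; intros; apply Rmult_comm.
    + unfold minus, plus, opp, mult, Re, Im; simpl. ring.
Qed.

(** The norm of [C_R_NormedModule] is the modulus, so differentiability becomes an explicit little-o
    estimate in [Cmod]. The chain rule along the path is proved from this form. *)
Lemma curve_derive_eps (f : R -> C) x l :
  curve_derive f x l <->
  forall eps : posreal, locally x (fun y =>
    Cmod (f y - f x - RtoC (y - x) * l)%C <= eps * Rabs (y - x)).
Proof.
  split.
  - intros [_ H] eps. specialize (H x (fun P HP => HP) eps).
    revert H. apply filter_imp. intros y Hy.
    rewrite Cmod_norm. eapply Rle_trans; [right | exact Hy].
    f_equal. now rewrite <- scal_R_Cmult.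
  - intros H. split. { apply (@is_linear_scal_l R_AbsRing C_R_NormedModule). }
    intros z Hz. apply (@is_filter_lim_locally_unique R_AbsRing R_NormedModule) in Hz. subst z.
    intros eps. generalize (H eps). apply filter_imp. intros y Hy.
    rewrite Cmod_norm in Hy. eapply Rle_trans; [right | exact Hy].
    f_equal. now rewrite <- scal_R_Cmult.
Qed.

Lemma locally_Cmod (z : C) (P : C -> Prop) :
  locally (T := C_UniformSpace) z P <-> exists d : posreal, forall z', Cmod (z' - z)%C < d -> P z'.
Proof.
  split.
  - intros H. apply locally_C in H. destruct H as [d Hd]. exists d. intros z' Hz. apply Hd.
    exact Hz.
  - intros [d Hd]. apply locally_C. exists d. intros z' Hz. apply Hd. exact Hz.
Qed.

Lemma filterlim_Cmod {T : Type} (F : (T -> Prop) -> Prop) {FF : Filter F} (f : T -> C) (l : C) :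
  filterlim f F (locally (T := C_UniformSpace) l) <->
  forall eps : posreal, F (fun y => Cmod (f y - l)%C < eps).
Proof.
  split.
  - intros H eps. apply (H (fun z => Cmod (z - l)%C < eps)). apply locally_Cmod.
    now exists eps.
  - intros H P HP. apply locally_Cmod in HP. destruct HP as [d Hd].
    generalize (H d). unfold filtermap. apply filter_imp. auto.
Qed.

Definition curve_cont (f : R -> C) (x : R) : Prop := @continuous R_UniformSpace C_UniformSpace f x.

Lemma curve_cont_components (f : R -> C) x :
  curve_cont f x <->
  continuous (fun t => Re (f t)) x /\ continuous (fun t => Im (f t)) x.
Proof.
  unfold curve_cont. split.
  - intros H; split.
    + apply (@continuous_comp R_UniformSpace C_UniformSpace R_UniformSpace f Re); auto.
      apply (@continuous_fst R_UniformSpace R_UniformSpace).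
    + apply (@continuous_comp R_UniformSpace C_UniformSpace R_UniformSpace f Im); auto.
      apply (@continuous_snd R_UniformSpace R_UniformSpace).
  - intros [H1 H2].
    apply (@continuous_ext R_UniformSpace C_UniformSpace (fun t => (Re (f t), Im (f t)))).
    { intros y. now destruct (f y). }
    apply (@continuous_comp_2 R_UniformSpace R_UniformSpace R_UniformSpace C_UniformSpace
             (fun t => Re (f t)) (fun t => Im (f t)) (fun a b => (a, b) : C) x H1 H2).
    intros P HP. unfold filtermap.
    apply (@filter_imp _ (@locally C_UniformSpace (Re (f x), Im (f x))) _ P);
      [now intros [a b] | exact HP].
Qed.

Lemma curve_cont_mult (f g : R -> C) x :
  curve_cont f x -> curve_cont g x -> curve_cont (fun t => f t * g t)%C x.
Proof.
  rewrite !curve_cont_components. intros [Hf1 Hf2] [Hg1 Hg2]. split.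
  - apply (@continuous_minus _ R_AbsRing R_NormedModule
             (fun t => Re (f t) * Re (g t)) (fun t => Im (f t) * Im (g t)));
      now apply (@continuous_mult _ R_AbsRing).
  - apply (@continuous_plus _ R_AbsRing R_NormedModule
             (fun t => Re (f t) * Im (g t)) (fun t => Im (f t) * Re (g t)));
      now apply (@continuous_mult _ R_AbsRing).
Qed.

Lemma curve_cont_plus (f g : R -> C) x :
  curve_cont f x -> curve_cont g x -> curve_cont (fun t => f t + g t)%C x.
Proof. apply (@continuous_plus _ R_AbsRing C_R_NormedModule). Qed.

Lemma curve_cont_minus (f g : R -> C) x :
  curve_cont f x -> curve_cont g x -> curve_cont (fun t => f t - g t)%C x.
Proof. apply (@continuous_minus _ R_AbsRing C_R_NormedModule). Qed.

Lemma curve_cont_const a x : curve_cont (fun _ => a) x.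
Proof. apply continuous_const. Qed.

Lemma continuous_sum_sq (u v : R -> R) x :
  continuous u x -> continuous v x -> continuous (fun t => u t ^ 2 + v t ^ 2) x.
Proof.
  intros Hu Hv.
  apply (continuous_ext (fun t => u t * u t + v t * v t)). { intros; simpl; ring. }
  apply (@continuous_plus _ R_AbsRing R_NormedModule (fun t => u t * u t) (fun t => v t * v t)).
  - now apply (@continuous_mult _ R_AbsRing u u).
  - now apply (@continuous_mult _ R_AbsRing v v).
Qed.

Lemma Cmod_sqr_pos (z : C) : z <> 0%C -> 0 < Re z ^ 2 + Im z ^ 2.
Proof. intros H. rewrite <- Cmod2_alt. apply pow_lt. exact (proj1 (Cmod_gt_0 z) H). Qed.

Lemma curve_cont_inv (f : R -> C) x :
  curve_cont f x -> f x <> 0%C -> curve_cont (fun t => / f t)%C x.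
Proof.
  rewrite !curve_cont_components. intros [H1 H2] H0.
  assert (Hm : continuous (fun t => / (Re (f t) ^ 2 + Im (f t) ^ 2)) x).
  { apply continuous_Rinv_comp.
    - now apply continuous_sum_sq.
    - apply Rgt_not_eq, Rlt_gt. now apply Cmod_sqr_pos. }
  split.
  - now apply (@continuous_mult _ R_AbsRing (fun t => Re (f t))).
  - apply (@continuous_mult _ R_AbsRing (fun t => - Im (f t))); auto.
    now apply (@continuous_opp _ R_AbsRing R_NormedModule).
Qed.

Lemma curve_derive_cont (f : R -> C) x l : curve_derive f x l -> curve_cont f x.
Proof.
  intros H. apply (@ex_derive_continuous R_AbsRing C_R_NormedModule). now exists l.
Qed.

(** * Continuity, derivatives and integrals on a closed segment *)

Definition clamp (a b x : R) : R := Rmax a (Rmin b x).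

Lemma clamp_segment a b x : a <= b -> segment a b (clamp a b x).
Proof.
  intros H. unfold segment, clamp. split; [apply Rmax_l | apply Rmax_lub; auto; apply Rmin_l].
Qed.

Lemma clamp_id a b x : segment a b x -> clamp a b x = x.
Proof.
  intros [H1 H2]. unfold clamp. rewrite Rmin_right by lra. now rewrite Rmax_right by lra.
Qed.

Lemma clamp_lipschitz a b x y : Rabs (clamp a b y - clamp a b x) <= Rabs (y - x).
Proof.
  unfold clamp.
  destruct (Rle_lt_dec b x), (Rle_lt_dec b y);
    rewrite ?(Rmin_left b x), ?(Rmin_left b y), ?(Rmin_right b x), ?(Rmin_right b y) by lra;
    apply Rabs_le_between; unfold Rmax; repeat destruct Rle_dec; split_Rabs; lra.
Qed.

Lemma clamp_interior a b x :
  a < x < b -> locally x (fun y => clamp a b y = y).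
Proof.
  intros Hx.
  assert (H : locally x (fun y => a < y < b)).
  { apply filter_and; [apply (open_gt a) | apply (open_lt b)]; lra. }
  revert H. apply filter_imp. intros y Hy. apply clamp_id. unfold segment; lra.
Qed.

(** Continuity of the restriction to the segment, one-sided at its ends. Composing with the
    projection [clamp] gives a curve that is continuous on the whole line, to which library results
    on continuity and integrability apply directly. *)
Definition seg_cont (a b : R) (f : R -> C) : Prop :=
  forall x, curve_cont (fun t => f (clamp a b t)) x.

Definition seg_derive (a b : R) (f f' : R -> C) : Prop :=
  forall x, a < x < b -> curve_derive f x (f' x).

Lemma seg_cont_of_within a b (f : R -> C) : a <= b ->
  (forall x, segment a b x ->
     filterlim f (within (segment a b) (locally x)) (@locally C_UniformSpace (f x))) ->
  seg_cont a b f.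
Proof.
  intros Hab H x. unfold curve_cont, continuous.
  apply filterlim_comp with (within (segment a b) (locally (clamp a b x))).
  2: { apply H. now apply clamp_segment. }
  intros P [d Hd]. exists d. intros y Hy. apply Hd.
  - eapply Rle_lt_trans; [apply clamp_lipschitz | exact Hy].
  - now apply clamp_segment.
Qed.

Lemma seg_cont_at a b f s : a <= b -> seg_cont a b f -> segment a b s ->
  forall eps : posreal, within (segment a b) (locally s) (fun t => Cmod (f t - f s)%C < eps).
Proof.
  intros Hab H Hs eps. unfold within.
  generalize (proj1 (filterlim_Cmod (locally s) _ _) (H s) eps).
  apply filter_imp. intros t Ht Hseg. now rewrite !clamp_id in Ht.
Qed.

Lemma is_derive_on_eps a b f df x : is_derive_on a b f df -> segment a b x ->
  forall eps : posreal, within (segment a b) (locally x) (fun y =>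
    Cmod (f y - f x - RtoC (y - x) * df x)%C <= eps * Rabs (y - x)).
Proof.
  intros H Hx eps. destruct (H x Hx) as [_ H1].
  specialize (fun h => H1 x h eps). revert H1.
  intros H1. refine (filter_imp _ _ _ (H1 _)).
  - intros y Hy. rewrite Cmod_norm. eapply Rle_trans; [right | exact Hy].
    f_equal. now rewrite <- scal_R_Cmult.
  - intros P HP. unfold within. revert HP. apply filter_imp. auto.
Qed.

Lemma is_derive_on_derive a b f df : is_derive_on a b f df -> seg_derive a b f df.
Proof.
  intros H x Hx. apply curve_derive_eps. intros eps.
  assert (Hs : segment a b x) by (unfold segment; lra).
  generalize (is_derive_on_eps a b f df x H Hs eps). unfold within. intros H1.
  assert (H2 : locally x (fun y => a < y < b)).
  { apply filter_and; [apply (open_gt a) | apply (open_lt b)]; lra. }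
  generalize (filter_and _ _ H1 H2). apply filter_imp.
  intros y [Hy1 Hy2]. apply Hy1. unfold segment; lra.
Qed.

Lemma is_derive_on_cont a b f df : a <= b -> is_derive_on a b f df -> seg_cont a b f.
Proof.
  intros Hab H. apply seg_cont_of_within; auto. intros x Hx.
  apply (filterdiff_continuous_aux (U := R_NormedModule) (V := C_R_NormedModule)
           (F := within (segment a b) (locally x)) f).
  - eexists. apply (H x Hx).
  - intros P HP. unfold within. revert HP. apply filter_imp. auto.
Qed.

Lemma seg_cont_const a b z : seg_cont a b (fun _ => z).
Proof. intros x. apply curve_cont_const. Qed.

Lemma seg_cont_plus a b (f g : R -> C) :
  seg_cont a b f -> seg_cont a b g -> seg_cont a b (fun t => f t + g t)%C.
Proof. intros Hf Hg x. now apply curve_cont_plus. Qed.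

Lemma seg_cont_minus a b (f g : R -> C) :
  seg_cont a b f -> seg_cont a b g -> seg_cont a b (fun t => f t - g t)%C.
Proof. intros Hf Hg x. now apply curve_cont_minus. Qed.

Lemma seg_cont_mult a b (f g : R -> C) :
  seg_cont a b f -> seg_cont a b g -> seg_cont a b (fun t => f t * g t)%C.
Proof. intros Hf Hg x. now apply curve_cont_mult. Qed.

Lemma seg_cont_inv a b (f : R -> C) : a <= b -> (forall x, segment a b x -> f x <> 0%C) ->
  seg_cont a b f -> seg_cont a b (fun t => / f t)%C.
Proof.
  intros Hab H Hf x. apply curve_cont_inv; auto. apply H. now apply clamp_segment.
Qed.

Lemma curve_cont_Cmod (f : R -> C) x : curve_cont f x -> continuous (fun t => Cmod (f t)) x.
Proof.
  intros H. apply curve_cont_components in H. destruct H as [H1 H2].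
  apply (continuous_comp (fun t => Re (f t) ^ 2 + Im (f t) ^ 2) sqrt);
    [now apply continuous_sum_sq | apply continuous_sqrt].
Qed.

Lemma seg_cont_bounded a b (f : R -> C) : a <= b -> seg_cont a b f ->
  exists B, 0 < B /\ forall x, segment a b x -> Cmod (f x) <= B.
Proof.
  intros Hab H.
  destruct (continuity_ab_maj (fun t => Cmod (f (clamp a b t))) a b Hab) as [m [Hm _]].
  { intros c _. apply continuity_pt_filterlim. exact (curve_cont_Cmod (fun t => f (clamp a b t)) c (H c)). }
  exists (Cmod (f (clamp a b m)) + 1). split.
  - generalize (Cmod_ge_0 (f (clamp a b m))). lra.
  - intros x Hx. generalize (Hm x Hx). rewrite (clamp_id a b x) by auto. lra.
Qed.

Lemma seg_nondecreasing a b (h h' : R -> R) :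
  (forall x, continuous (fun t => h (clamp a b t)) x) ->
  (forall x, a < x < b -> is_derive h x (h' x) /\ 0 <= h' x) ->
  forall s t, a <= s -> s <= t -> t <= b -> h s <= h t.
Proof.
  intros Hc Hd s t Has Hst Htb.
  (* The intermediate point may be an end of the segment, where nothing is known about [h']. Taking
     [Rmax 0 (h' x)] as the derivative changes nothing inside and makes the sign available at every
     point. *)
  destruct (MVT_gen (fun t => h (clamp a b t)) s t (fun x => Rmax 0 (h' x))) as [c [_ Hc']].
  - rewrite Rmin_left, Rmax_right by lra. intros x Hx.
    destruct (Hd x) as [H1 H2]; [lra|]. rewrite Rmax_right by lra.
    apply (is_derive_ext_loc h); auto.
    assert (Hx' : a < x < b) by lra.
    generalize (clamp_interior a b x Hx'). apply filter_imp. intros y ->. reflexivity.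
  - intros x _. apply continuity_pt_filterlim, Hc.
  - rewrite !clamp_id in Hc' by (unfold segment; lra).
    assert (0 <= Rmax 0 (h' c) * (t - s)).
    { apply Rmult_le_pos; [apply Rmax_l | lra]. }
    lra.
Qed.

(** The mean value theorem fails for complex values, so the real and imaginary parts are treated
    separately; each of them and its opposite is nondecreasing. *)
Lemma seg_constant a b (f : R -> C) : a <= b -> seg_cont a b f -> seg_derive a b f (fun _ => 0%C) ->
  f b = f a.
Proof.
  intros Hab Hc Hd.
  assert (H : forall h : R -> R, (forall x, continuous (fun t => h (clamp a b t)) x) ->
     (forall x, a < x < b -> is_derive h x 0) -> h b = h a).
  { intros h H1 H2. apply Rle_antisym.
    - apply Ropp_le_cancel.
      apply (seg_nondecreasing a b (fun t => - h t) (fun _ => 0)); try lra.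
      + intros x. now apply (@continuous_opp _ R_AbsRing R_NormedModule).
      + intros x Hx. split; [|lra]. rewrite <- Ropp_0.
        apply (@is_derive_opp R_AbsRing R_NormedModule). auto.
    - apply (seg_nondecreasing a b h (fun _ => 0)); try lra; auto.
      intros x Hx. split; [auto|lra]. }
  assert (Hc1 := fun x => proj1 (curve_cont_components _ _) (Hc x)).
  assert (Hd1 := fun x Hx => proj1 (curve_derive_components _ _ _) (Hd x Hx)).
  assert (E1 : Re (f b) = Re (f a)).
  { apply (H (fun t => Re (f t))); [intros x; apply Hc1 | intros x Hx; apply (Hd1 x Hx)]. }
  assert (E2 : Im (f b) = Im (f a)).
  { apply (H (fun t => Im (f t))); [intros x; apply Hc1 | intros x Hx; apply (Hd1 x Hx)]. }
  revert E1 E2. destruct (f a), (f b). simpl. now intros -> ->.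
Qed.

Definition CRInt (f : R -> C) (a b : R) : C := @RInt C_R_CompleteNormedModule f a b.

(** The clamped integrand is continuous on the whole line, so its integral from [a] is
    differentiable everywhere. It agrees with the original integrand on the segment, which gives
    both the value at [b] and the derivative inside. *)
Lemma seg_primitive a b (f : R -> C) : a <= b -> seg_cont a b f ->
  exists I : R -> C, I a = 0%C /\ I b = CRInt f a b /\ seg_cont a b I /\ seg_derive a b I f.
Proof.
  intros Hab Hf.
  set (g := fun t => f (clamp a b t)).
  assert (Hg : forall x, curve_cont g x) by exact Hf.
  assert (HI : forall x, curve_derive (fun t => CRInt g a t) x (g x)).
  { intros x. apply (@is_derive_RInt C_R_NormedModule g _ a x); [|apply Hg].
    apply filter_forall. intros t. apply (@RInt_correct C_R_CompleteNormedModule).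
    apply (@ex_RInt_continuous C_R_CompleteNormedModule). intros z _. apply Hg. }
  exists (fun t => CRInt g a t). split; [|split; [|split]].
  - apply (@RInt_point C_R_CompleteNormedModule).
  - apply (@RInt_ext C_R_CompleteNormedModule). intros x.
    rewrite Rmin_left, Rmax_right by auto. intros Hx. unfold g.
    now rewrite clamp_id by (unfold segment; lra).
  - intros x.
    apply (@continuous_comp R_UniformSpace R_UniformSpace C_UniformSpace
             (clamp a b) (fun t => CRInt g a t)).
    + intros P [d Hd]. exists d. intros y Hy. apply Hd.
      eapply Rle_lt_trans; [apply clamp_lipschitz | exact Hy].
    + eapply curve_derive_cont, HI.
  - intros x Hx. eapply curve_derive_eq; [apply HI|].
    unfold g. now rewrite clamp_id by (unfold segment; lra).
Qed.

(* Differentiability inside and continuity up to the ends suffice, so that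
   one-sided derivatives at the ends need not be considered. *)
Lemma seg_FTC a b (W W' : R -> C) : a <= b -> seg_cont a b W -> seg_derive a b W W' ->
  seg_cont a b W' -> CRInt W' a b = (W b - W a)%C.
Proof.
  intros Hab HW Hd HW'.
  destruct (seg_primitive a b W' Hab HW') as [I [Ia [Ib [HI HI']]]].
  assert (K : (I b - W b)%C = (I a - W a)%C).
  { apply (seg_constant a b (fun t => I t - W t)%C Hab).
    - now apply seg_cont_minus.
    - intros x Hx. eapply curve_derive_eq.
      + apply curve_derive_minus; [apply HI' | apply Hd]; auto.
      + cbv beta. ring. }
  rewrite <- Ib. replace (I b) with ((I b - W b) + W b)%C by ring. rewrite K, Ia. ring.
Qed.

Lemma CRInt_scal a b (k : C) (f : R -> C) : a <= b -> seg_cont a b f ->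
  CRInt (fun t => k * f t)%C a b = (k * CRInt f a b)%C.
Proof.
  intros Hab Hf.
  destruct (seg_primitive a b f Hab Hf) as [I [Ia [Ib [HI HI']]]].
  rewrite (seg_FTC a b (fun t => k * I t)%C); auto.
  - rewrite Ia, Ib. ring.
  - apply seg_cont_mult; [apply seg_cont_const | auto].
  - intros x Hx. eapply curve_derive_eq.
    + apply curve_derive_mult; [apply curve_derive_const | apply HI'; auto].
    + cbv beta. ring.
  - apply seg_cont_mult; [apply seg_cont_const | auto].
Qed.

Lemma CRInt_minus a b (f g : R -> C) : a <= b -> seg_cont a b f -> seg_cont a b g ->
  CRInt (fun t => f t - g t)%C a b = (CRInt f a b - CRInt g a b)%C.
Proof.
  intros Hab Hf Hg.
  assert (H : forall h, seg_cont a b h -> @ex_RInt C_R_NormedModule h a b).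
  { intros h Hh. apply (@ex_RInt_ext C_R_NormedModule (fun t => h (clamp a b t))).
    - intros x. rewrite Rmin_left, Rmax_right by auto. intros Hx.
      now rewrite clamp_id by (unfold segment; lra).
    - apply (@ex_RInt_continuous C_R_CompleteNormedModule). intros z _. apply Hh. }
  apply (@RInt_minus C_R_CompleteNormedModule); auto.
Qed.

Lemma CRInt_bound a b f B : a <= b -> seg_cont a b f ->
  (forall x, segment a b x -> Cmod (f x) <= B) -> Cmod (CRInt f a b) <= (b - a) * B.
Proof.
  intros Hab Hf HB. rewrite Cmod_norm.
  apply (@norm_RInt_le_const C_R_NormedModule f a b); auto.
  - intros x Hx. generalize (HB x Hx). now rewrite Cmod_norm.
  - apply (@RInt_correct C_R_CompleteNormedModule).
    apply (@ex_RInt_ext C_R_NormedModule (fun t => f (clamp a b t))).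
    + intros x. rewrite Rmin_left, Rmax_right by auto. intros Hx.
      now rewrite clamp_id by (unfold segment; lra).
    + apply (@ex_RInt_continuous C_R_CompleteNormedModule). intros z _. apply Hf.
Qed.

(** * Gronwall estimates *)

Lemma Re_inner_le (z w : C) : Rabs (Re z * Re w + Im z * Im w) <= Cmod z * Cmod w.
Proof.
  replace (Re z * Re w + Im z * Im w) with (Re (Cconj z * w)%C)
    by (destruct z, w; simpl; ring).
  rewrite <- (Cmod_conj z), <- Cmod_mult. apply re_le_Cmod.
Qed.

(** Under |Z'| <= kappa Z, the product Z e^(kappa x) increases and Z e^(-kappa x) decreases, so the
    bound propagates in both directions. Both are used: from y_b towards the wall for the dependence
    on c, and from the wall to y_b for the nonvanishing of p(0). *)
Lemma seg_exp_bounds a b (Z Z' : R -> R) kappa : a <= b -> 0 <= kappa ->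
  (forall x, continuous (fun t => Z (clamp a b t)) x) ->
  (forall x, a < x < b -> is_derive Z x (Z' x) /\ Rabs (Z' x) <= kappa * Z x) ->
  (forall x, segment a b x -> 0 <= Z x) ->
  forall s t, segment a b s -> segment a b t -> Z s <= Z t * exp (kappa * (b - a)).
Proof.
  intros Hab Hk Hc Hd Hpos s t [Hs1 Hs2] [Ht1 Ht2].
  assert (HZc : forall e x, continuous (fun t => Z (clamp a b t) * exp (e * clamp a b t)) x).
  { intros e x. apply (@continuous_mult _ R_AbsRing); [apply Hc|].
    apply (continuous_comp (clamp a b) (fun t => exp (e * t))).
    - intros P [d Hd']. exists d. intros y Hy. apply Hd'.
      eapply Rle_lt_trans; [apply clamp_lipschitz | exact Hy].
    - apply continuous_exp_comp. apply (@continuous_mult _ R_AbsRing);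
        [apply continuous_const | apply continuous_id]. }
  assert (HZd : forall e x, a < x < b ->
    is_derive (fun t => Z t * exp (e * t)) x ((Z' x + e * Z x) * exp (e * x))).
  { intros e x Hx. evar_last.
    - apply (@is_derive_mult R_AbsRing Z (fun t => exp (e * t))).
      + apply (Hd x Hx).
      + auto_derive; auto.
      + intros; apply Rmult_comm.
    - unfold plus, mult; simpl. ring. }
  destruct (Rle_lt_dec s t) as [Hst | Hts].
  - assert (H : Z s * exp (kappa * s) <= Z t * exp (kappa * t)).
    { apply (seg_nondecreasing a b (fun t => Z t * exp (kappa * t))
               (fun x => (Z' x + kappa * Z x) * exp (kappa * x))); auto.
      intros x Hx. split; [auto|]. apply Rmult_le_pos; [|left; apply exp_pos].
      destruct (Hd x Hx) as [_ H]. apply Rabs_le_between in H. lra. }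
    apply Rmult_le_reg_r with (exp (kappa * s)); [apply exp_pos|].
    eapply Rle_trans; [exact H|]. rewrite Rmult_assoc, <- exp_plus.
    apply Rmult_le_compat_l; [apply Hpos; split; auto|].
    destruct (Req_dec (kappa * t) (kappa * (b - a) + kappa * s)) as [<-|Hne]; [lra|].
    left. apply exp_increasing.
    assert (kappa * t <= kappa * (b - a) + kappa * s); [|lra].
    rewrite <- Rmult_plus_distr_l. apply Rmult_le_compat_l; lra.
  - assert (H : - (Z t * exp (- kappa * t)) <= - (Z s * exp (- kappa * s))).
    { apply (seg_nondecreasing a b (fun t => - (Z t * exp (- kappa * t)))
               (fun x => - ((Z' x + - kappa * Z x) * exp (- kappa * x)))); auto; try lra.
      - intros x. apply (@continuous_opp _ R_AbsRing R_NormedModule), HZc.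
      - intros x Hx. split.
        + apply (@is_derive_opp R_AbsRing R_NormedModule); auto.
        + rewrite Ropp_mult_distr_l. apply Rmult_le_pos; [|left; apply exp_pos].
          destruct (Hd x Hx) as [_ H]. apply Rabs_le_between in H. lra. }
    apply Rmult_le_reg_r with (exp (- kappa * s)); [apply exp_pos|].
    apply Rle_trans with (Z t * exp (- kappa * t)); [lra|].
    rewrite Rmult_assoc, <- exp_plus.
    apply Rmult_le_compat_l; [apply Hpos; split; auto|].
    destruct (Req_dec (- kappa * t) (kappa * (b - a) + - kappa * s)) as [<-|Hne]; [lra|].
    left. apply exp_increasing.
    assert (kappa * (s - t) <= kappa * (b - a)); [|lra].
    apply Rmult_le_compat_l; lra.
Qed.

Lemma is_derive_sum_sq (u1 u2 v1 v2 : R -> R) k x l1 l2 m1 m2 :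
  is_derive u1 x l1 -> is_derive u2 x l2 -> is_derive v1 x m1 -> is_derive v2 x m2 ->
  is_derive (fun t => u1 t ^ 2 + u2 t ^ 2 + (v1 t ^ 2 + v2 t ^ 2) + k) x
    (2 * (u1 x * l1 + u2 x * l2) + 2 * (v1 x * m1 + v2 x * m2)).
Proof.
  intros U1 U2 V1 V2. auto_derive.
  - repeat split; eexists; eassumption.
  - assert (E : forall u l, is_derive u x l -> Derive (fun t => u t) x = l)
      by (intros u l; apply is_derive_unique).
    rewrite (E _ _ U1), (E _ _ U2), (E _ _ V1), (E _ _ V2). ring.
Qed.

(** Squared moduli are used because the modulus is not differentiable at 0. For Z = |f|^2 + |q|^2 +
    2 delta^2 the cross terms obey 4N|f||q| <= 2N(|f|^2 + |q|^2), and the forcing obeys 2 delta |f|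
    <= |f|^2 + delta^2, likewise for q; hence |Z'| <= (2N + 1) Z. The constant 2 delta^2 in Z makes
    this inequality homogeneous. *)
Lemma gronwall_system a b (f q f' q' : R -> C) N delta m : a <= b ->
  seg_cont a b f -> seg_cont a b q -> seg_derive a b f f' -> seg_derive a b q q' ->
  0 <= N -> 0 <= delta ->
  (forall s, segment a b s -> Cmod (f' s) <= N * Cmod (q s) + delta) ->
  (forall s, segment a b s -> Cmod (q' s) <= N * Cmod (f s) + delta) ->
  forall t, segment a b t -> Cmod (f t) <= m -> Cmod (q t) <= m ->
  forall s, segment a b s ->
    Cmod (f s) <= 2 * (m + delta) * exp ((2 * N + 1) * (b - a)) /\
    Cmod (q s) <= 2 * (m + delta) * exp ((2 * N + 1) * (b - a)).
Proof.
  intros Hab Hf Hq Df Dq HN Hdelta Bf Bq t Ht Hft Hqt s Hs.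
  set (Z := fun x => Cmod (f x) ^ 2 + Cmod (q x) ^ 2 + 2 * delta ^ 2).
  set (Z' := fun x => 2 * (Re (f x) * Re (f' x) + Im (f x) * Im (f' x))
                    + 2 * (Re (q x) * Re (q' x) + Im (q x) * Im (q' x))).
  assert (HZ : Z s <= Z t * exp ((2 * N + 1) * (b - a))).
  { apply (seg_exp_bounds a b Z Z'); auto; try lra.
    - intros x. unfold Z.
      assert (Hc1 := curve_cont_Cmod _ _ (Hf x)). assert (Hc2 := curve_cont_Cmod _ _ (Hq x)).
      apply (@continuous_plus _ R_AbsRing R_NormedModule); [|apply continuous_const].
      now apply continuous_sum_sq.
    - intros x Hx. split.
      + destruct (proj1 (curve_derive_components _ _ _) (Df x Hx)) as [F1 F2].
        destruct (proj1 (curve_derive_components _ _ _) (Dq x Hx)) as [Q1 Q2].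
        apply (is_derive_ext (fun x => Re (f x) ^ 2 + Im (f x) ^ 2 + (Re (q x) ^ 2 + Im (q x) ^ 2)
                 + 2 * delta ^ 2)).
        { intros y. unfold Z. now rewrite !Cmod2_alt. }
        now apply (is_derive_sum_sq (fun t => Re (f t)) (fun t => Im (f t))
                 (fun t => Re (q t)) (fun t => Im (q t))).
      + assert (Hx' : segment a b x) by (unfold segment; lra).
        specialize (Bf x Hx'). specialize (Bq x Hx').
        generalize (Re_inner_le (f x) (f' x)) (Re_inner_le (q x) (q' x)).
        generalize (Cmod_ge_0 (f x)) (Cmod_ge_0 (q x)).
        unfold Z, Z'. set (u := Cmod (f x)) in *. set (v := Cmod (q x)) in *.
        intros Hu Hv I1 I2.
        assert (J1 : u * Cmod (f' x) <= u * (N * v + delta)) by now apply Rmult_le_compat_l.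
        assert (J2 : v * Cmod (q' x) <= v * (N * u + delta)) by now apply Rmult_le_compat_l.
        assert (J3 : 0 <= N * (u - v) ^ 2) by (apply Rmult_le_pos; auto; apply pow2_ge_0).
        assert (J4 : 0 <= N * delta ^ 2) by (apply Rmult_le_pos; auto; apply pow2_ge_0).
        assert (J5 := pow2_ge_0 (u - delta)). assert (J6 := pow2_ge_0 (v - delta)).
        apply Rabs_le_between in I1. apply Rabs_le_between in I2.
        apply Rabs_le_between. split; lra.
    - intros x _. unfold Z. generalize (pow2_ge_0 (Cmod (f x))) (pow2_ge_0 (Cmod (q x))) (pow2_ge_0 delta).
      lra. }
  revert HZ. set (G := exp ((2 * N + 1) * (b - a))). intros HZ.
  assert (HG : 1 <= G).
  { unfold G. eapply Rle_trans; [|apply exp_ineq1_le].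
    assert (0 <= (2 * N + 1) * (b - a)) by (apply Rmult_le_pos; lra). lra. }
  assert (Hm : 0 <= m) by (eapply Rle_trans; [apply Cmod_ge_0 | exact Hft]).
  (* Since G >= 1, one factor G may be traded for G^2, and the bound becomes a perfect square whose
     root is the claimed constant. *)
  assert (Hb : Z s <= (2 * (m + delta) * G) ^ 2).
  { eapply Rle_trans; [exact HZ|].
    apply Rle_trans with ((2 * m ^ 2 + 2 * delta ^ 2) * G).
    - apply Rmult_le_compat_r; [lra|]. unfold Z.
      assert (forall u, 0 <= u -> u <= m -> u ^ 2 <= m ^ 2) by (intros; apply pow_incr; lra).
      generalize (H _ (Cmod_ge_0 (f t)) Hft) (H _ (Cmod_ge_0 (q t)) Hqt). lra.
    - replace ((2 * (m + delta) * G) ^ 2) with ((4 * (m + delta) ^ 2 * G) * G) by ring.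
      apply Rmult_le_compat_r; [lra|].
      assert (0 <= m * delta) by now apply Rmult_le_pos.
      assert (0 <= (m + delta) ^ 2 * (G - 1)) by (apply Rmult_le_pos; [apply pow2_ge_0 | lra]).
      generalize (pow2_ge_0 m) (pow2_ge_0 delta). lra. }
  assert (Hr : 0 <= 2 * (m + delta) * G) by (apply Rmult_le_pos; lra).
  unfold Z in Hb.
  generalize (pow2_ge_0 (Cmod (f s))) (pow2_ge_0 (Cmod (q s))) (pow2_ge_0 delta).
  intros. split; (apply Rsqr_incr_0_var; [unfold Rsqr; lra | auto]).
Qed.

(** * Local inversion *)

Lemma Cderive_eps (f : C -> C) (z l : C) :
  @is_derive C_AbsRing C_NormedModule f z l <->
  forall eps : posreal, exists d : posreal, forall z', Cmod (z' - z)%C < d ->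
    Cmod (f z' - f z - (z' - z) * l)%C <= eps * Cmod (z' - z)%C.
Proof.
  split.
  - intros [_ H] eps. specialize (H z (fun P HP => HP) eps).
    destruct H as [d Hd]. exists d. intros z' Hz. exact (Hd z' Hz).
  - intros H. split. { apply (@is_linear_scal_l C_AbsRing C_NormedModule). }
    intros x Hx. apply (@is_filter_lim_locally_unique C_AbsRing (AbsRing_NormedModule C_AbsRing)) in Hx.
    subst x. intros eps. destruct (H eps) as [d Hd]. exists d. intros z' Hz. exact (Hd z' Hz).
Qed.

(** Complex derivatives are obtained from second-order remainder bounds: for the reciprocal, for the
    inverse branch, and for the dispersion function at a degenerate eigenvalue. *)
Lemma Cderive_of_quadratic (f : C -> C) (z l : C) (d : posreal) (B : R) :
  (forall z', Cmod (z' - z)%C < d ->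
    Cmod (f z' - f z - (z' - z) * l)%C <= B * Cmod (z' - z)%C ^ 2) ->
  @is_derive C_AbsRing C_NormedModule f z l.
Proof.
  intros H. apply Cderive_eps. intros eps.
  (* [B] may have any sign or vanish; |B| + 1 is a positive substitute by which eps can be
     divided. *)
  assert (HB : 0 < Rabs B + 1) by (generalize (Rabs_pos B); lra).
  assert (Hp : 0 < Rmin d (eps / (Rabs B + 1))).
  { apply Rmin_pos; [apply cond_pos|]. apply Rdiv_lt_0_compat; auto. apply cond_pos. }
  exists (mkposreal _ Hp). simpl. intros z' Hz.
  assert (Hz1 := Rlt_le_trans _ _ _ Hz (Rmin_l _ _)).
  assert (Hz2 := Rlt_le_trans _ _ _ Hz (Rmin_r _ _)).
  eapply Rle_trans; [apply (H z' Hz1)|].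
  replace (B * Cmod (z' - z) ^ 2) with (B * Cmod (z' - z) * Cmod (z' - z)) by ring.
  apply Rmult_le_compat_r; [apply Cmod_ge_0|].
  apply Rle_trans with ((Rabs B + 1) * Cmod (z' - z)).
  - apply Rmult_le_compat_r; [apply Cmod_ge_0|]. generalize (Rle_abs B). lra.
  - apply Rmult_le_reg_l with (/ (Rabs B + 1)); [now apply Rinv_0_lt_compat|].
    rewrite <- Rmult_assoc, Rinv_l by lra. unfold Rdiv in Hz2. lra.
Qed.

Lemma Cmod_minus_sym (x y : C) : Cmod (x - y)%C = Cmod (y - x)%C.
Proof. rewrite <- Cmod_opp. f_equal. ring. Qed.

Lemma Cmod_triangle_minus (x y z : C) : Cmod (x - z)%C <= Cmod (x - y)%C + Cmod (y - z)%C.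
Proof. replace (x - z)%C with ((x - y) + (y - z))%C by ring. apply Cmod_triangle. Qed.

(** Picard iteration from [c0]. The condition on [phi c0] keeps the iterates in the closed disc,
    since |phi x - c0| <= |x - c0|/2 + rho/2. The increments are at most rho/2^n, so completeness
    enters through an absolutely convergent series, whose partial sums are the iterates shifted by
    [c0]. *)
Lemma contraction_fixpoint (phi : C -> C) (c0 : C) (rho : R) :
  (forall x y, Cmod (x - c0)%C <= rho -> Cmod (y - c0)%C <= rho ->
     Cmod (phi x - phi y)%C <= Cmod (x - y)%C / 2) ->
  Cmod (phi c0 - c0)%C <= rho / 2 ->
  exists x, Cmod (x - c0)%C <= rho /\ phi x = x.
Proof.
  intros Hphi H0.
  assert (Hrho : 0 <= rho) by (generalize (Cmod_ge_0 (phi c0 - c0)%C); lra).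
  assert (Hc0 : Cmod (c0 - c0)%C <= rho).
  { replace (c0 - c0)%C with (RtoC 0) by ring. now rewrite Cmod_0. }
  set (x := fix x n := match n with O => c0 | S m => phi (x m) end).
  assert (Hin : forall n, Cmod (x n - c0)%C <= rho).
  { induction n as [|n IH]; simpl; auto.
    eapply Rle_trans; [apply (Cmod_triangle_minus _ (phi c0))|].
    generalize (Hphi _ _ IH Hc0). lra. }
  set (a := fun n => (x (S n) - x n)%C).
  assert (Ha : forall n, Cmod (a n) <= rho * (/ 2) ^ n).
  { induction n as [|n IH].
    - unfold a; simpl. lra.
    - unfold a in *. simpl x in *. eapply Rle_trans; [apply Hphi; auto; apply (Hin (S n))|].
      simpl pow. lra. }
  assert (Hs : @ex_series R_AbsRing C_R_NormedModule a).
  { apply (@ex_series_le R_AbsRing C_R_CompleteNormedModule a (fun n => rho * (/ 2) ^ n)).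
    - intros n. generalize (Ha n). now rewrite Cmod_norm.
    - apply (@ex_series_scal R_AbsRing R_NormedModule rho (fun n => (/ 2) ^ n)).
      apply ex_series_geom. rewrite Rabs_pos_eq; lra. }
  destruct Hs as [l Hl].
  assert (Hsum : forall n, (sum_n (G := C_R_NormedModule) a n = x (S n) - c0)%C).
  { induction n as [|n IH].
    - rewrite sum_O. reflexivity.
    - rewrite sum_Sn, IH. change ((x (S n) - c0) + a (S n) = x (S (S n)) - c0)%C. unfold a. ring. }
  assert (Hlim : forall eps : posreal, eventually (fun n => Cmod (x (S n) - (c0 + l))%C < eps)).
  { intros eps. generalize (proj1 (filterlim_Cmod eventually _ l) Hl eps).
    apply filter_imp. intros n. rewrite Hsum.
    now replace (x (S n) - c0 - l)%C with (x (S n) - (c0 + l))%C by ring. }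
  assert (Hinl : Cmod (c0 + l - c0)%C <= rho).
  { apply le_epsilon. intros eps Heps.
    destruct (Hlim (mkposreal eps Heps)) as [N HN]. specialize (HN N (Nat.le_refl N)). simpl in HN.
    eapply Rle_trans; [apply (Cmod_triangle_minus _ (phi (x N)))|].
    rewrite Cmod_minus_sym. generalize (Hin (S N)). simpl. lra. }
  exists (c0 + l)%C. split; auto.
  assert (E : Cmod (phi (c0 + l) - (c0 + l))%C <= 0).
  { apply le_epsilon. intros eps Heps.
    assert (Heps' : 0 < eps / 2) by lra.
    destruct (Hlim (mkposreal _ Heps')) as [N HN]. simpl in HN.
    assert (H1 := HN N (Nat.le_refl N)). assert (H2 := HN (S N) (Nat.le_succ_diag_r N)).
    eapply Rle_trans; [apply (Cmod_triangle_minus _ (phi (x (S N))))|].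
    assert (H3 := Hphi _ _ Hinl (Hin (S N))). rewrite (Cmod_minus_sym (c0 + l)) in H3.
    simpl in *. lra. }
  assert (E' : Cmod (phi (c0 + l) - (c0 + l))%C = 0) by (generalize (Cmod_ge_0 (phi (c0 + l) - (c0 + l))%C); lra).
  apply Cmod_eq_0 in E'. replace (phi (c0 + l)%C) with (phi (c0 + l) - (c0 + l) + (c0 + l))%C by ring.
  rewrite E'. ring.
Qed.

Lemma in_disc_center z r : 0 < r -> in_disc z r z.
Proof. intros H. unfold in_disc. replace (z - z)%C with (RtoC 0) by ring. now rewrite Cmod_0. Qed.

Lemma in_disc_le z r r' c : r <= r' -> in_disc z r c -> in_disc z r' c.
Proof. unfold in_disc. lra. Qed.

Section LocalInverse.

Variables (G : C -> C) (H : C -> C -> C) (c0 : C) (r L : R).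
Hypothesis r_pos : 0 < r.
Hypothesis L_nonneg : 0 <= L.
Hypothesis G_c0 : G c0 = RtoC 0.
Hypothesis G_factor : forall c c', in_disc c0 r c -> in_disc c0 r c' ->
  (G c' - G c = (c' - c) * H c c')%C.
Hypothesis H_lipschitz : forall c c' d d', in_disc c0 r c -> in_disc c0 r c' ->
  in_disc c0 r d -> in_disc c0 r d' ->
  Cmod (H c c' - H d d')%C <= L * (Cmod (c - d)%C + Cmod (c' - d')%C).
Hypothesis H_c0 : H c0 c0 <> RtoC 0.

Let h := Cmod (H c0 c0).

Let h_pos : 0 < h.
Proof. exact (proj1 (Cmod_gt_0 _) H_c0). Qed.

(** With h = |H(c0, c0)|, two speeds in this disc change H by at most 2 L h / (4 (L + 1)) <= h/2, so
    |H| stays above h/2. The summand 1 keeps the quotient defined when L = 0. *)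
Definition inverse_radius : R := Rmin r (Cmod (H c0 c0) / (4 * (L + 1))).

Lemma inverse_radius_pos : 0 < inverse_radius.
Proof.
  apply Rmin_pos; auto. apply Rdiv_lt_0_compat; [exact h_pos|lra].
Qed.

Lemma inverse_radius_le : inverse_radius <= r.
Proof. apply Rmin_l. Qed.

Let in_big c : in_disc c0 inverse_radius c -> in_disc c0 r c.
Proof. apply in_disc_le, inverse_radius_le. Qed.

Let c0_big : in_disc c0 r c0.
Proof. now apply in_disc_center. Qed.

Lemma H_near c c' : in_disc c0 inverse_radius c -> in_disc c0 inverse_radius c' ->
  Cmod (H c c' - H c0 c0)%C <= h / 2.
Proof.
  intros Hc Hc'. eapply Rle_trans; [apply H_lipschitz; auto|].
  unfold in_disc in *. assert (Hr : inverse_radius <= h / (4 * (L + 1))) by apply Rmin_r.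
  assert (HL : (L + 1) * (h / (4 * (L + 1))) = h / 4) by (field; lra).
  apply Rle_trans with ((L + 1) * (2 * (h / (4 * (L + 1))))); [|lra].
  apply Rmult_le_compat; try lra.
  apply Rplus_le_le_0_compat; apply Cmod_ge_0.
Qed.

Lemma H_lower c c' : in_disc c0 inverse_radius c -> in_disc c0 inverse_radius c' ->
  h / 2 <= Cmod (H c c').
Proof.
  intros Hc Hc'. assert (K := H_near c c' Hc Hc').
  assert (T : h <= Cmod (H c c') + Cmod (H c0 c0 - H c c')%C).
  { unfold h. replace (H c0 c0) with (H c c' + (H c0 c0 - H c c'))%C at 1 by ring. apply Cmod_triangle. }
  rewrite Cmod_minus_sym in T. lra.
Qed.

(** The factor H has modulus at least h/2, which makes G injective with a quantitative bound: this
    yields uniqueness of the eigenvalue and the Lipschitz continuity of the inverse. *)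
Lemma G_expansive c c' : in_disc c0 inverse_radius c -> in_disc c0 inverse_radius c' ->
  Cmod (c' - c)%C <= 2 / h * Cmod (G c' - G c)%C.
Proof.
  intros Hc Hc'. rewrite G_factor, Cmod_mult by auto.
  assert (K := H_lower c c' Hc Hc').
  apply Rle_trans with (2 / h * (Cmod (c' - c)%C * (h / 2))).
  - right. field. lra.
  - apply Rmult_le_compat_l; [left; apply Rdiv_lt_0_compat; lra|].
    apply Rmult_le_compat_l; [apply Cmod_ge_0 | auto].
Qed.

Lemma G_expansive_center c : in_disc c0 inverse_radius c -> Cmod (c - c0)%C <= 2 / h * Cmod (G c).
Proof.
  intros Hc. generalize (G_expansive c0 c (in_disc_center _ _ inverse_radius_pos) Hc).
  rewrite G_c0. now replace (G c - 0)%C with (G c) by ring.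
Qed.

(** The error equals (c - c0)(H(c0, c0) - H(c0, c))/H(c0, c0), and the Lipschitz bound on H supplies
    the second factor |c - c0|. *)
Lemma G_linearization c : in_disc c0 inverse_radius c ->
  Cmod (c - c0 - G c / H c0 c0)%C <= L / h * Cmod (c - c0)%C ^ 2.
Proof.
  intros Hc.
  assert (E : G c = ((c - c0) * H c0 c)%C).
  { rewrite <- G_factor by auto. rewrite G_c0. ring. }
  replace (c - c0 - G c / H c0 c0)%C with ((c - c0) * (H c0 c0 - H c0 c) / H c0 c0)%C
    by (rewrite E; field; auto).
  rewrite Cmod_div, Cmod_mult by auto.
  assert (K : Cmod (H c0 c0 - H c0 c)%C <= L * Cmod (c - c0)%C).
  { eapply Rle_trans; [apply H_lipschitz; auto|].
    replace (c0 - c0)%C with (RtoC 0) by ring. rewrite Cmod_0, (Cmod_minus_sym c0 c). lra. }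
  apply Rle_trans with (Cmod (c - c0)%C * (L * Cmod (c - c0)%C) / h); [|right; field; lra].
  apply Rmult_le_compat_r; [left; now apply Rinv_0_lt_compat|].
  apply Rmult_le_compat_l; [apply Cmod_ge_0 | auto].
Qed.

(** Newton's iteration with the slope frozen at H(c0, c0). Its contraction factor is |H(c0, c0) -
    H(y, x)|/h <= 1/2. The first step has length |A|/h, so the radius [rho] is twice that, and the
    bound on A keeps it below half of [inverse_radius]. *)
Lemma G_surjective A : Cmod A < inverse_radius * h / 4 ->
  exists c, in_disc c0 inverse_radius c /\ G c = A.
Proof.
  intros HA. set (rho := 2 * Cmod A / h).
  assert (Hrho : rho < inverse_radius).
  { apply Rlt_le_trans with (2 * (inverse_radius * h / 4) / h).
    - apply Rmult_lt_compat_r; [now apply Rinv_0_lt_compat | lra].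
    - assert (K := inverse_radius_pos).
      replace (2 * (inverse_radius * h / 4) / h) with (inverse_radius / 2) by (field; lra). lra. }
  destruct (contraction_fixpoint (fun x => x - (G x - A) / H c0 c0)%C c0 rho) as [c [Hc E]].
  - intros x y Hx Hy.
    assert (Hx' : in_disc c0 inverse_radius x) by (unfold in_disc; lra).
    assert (Hy' : in_disc c0 inverse_radius y) by (unfold in_disc; lra).
    replace (x - (G x - A) / H c0 c0 - (y - (G y - A) / H c0 c0))%C
      with ((x - y) - (G x - G y) / H c0 c0)%C by (field; auto).
    rewrite G_factor by auto.
    replace (x - y - (x - y) * H y x / H c0 c0)%C
      with ((x - y) * ((H c0 c0 - H y x) / H c0 c0))%C by (field; auto).
    rewrite Cmod_mult, Cmod_div by auto.
    apply Rmult_le_compat_l; [apply Cmod_ge_0|].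
    rewrite Cmod_minus_sym.
    apply Rle_trans with ((h / 2) / h); [|right; field; lra].
    apply Rmult_le_compat_r; [left; now apply Rinv_0_lt_compat|].
    now apply H_near.
  - rewrite G_c0.
    replace (c0 - (0 - A) / H c0 c0 - c0)%C with (A / H c0 c0)%C by (field; auto).
    rewrite Cmod_div by auto. unfold rho, h. right. field. apply Rgt_not_eq. exact h_pos.
  - exists c. split; [unfold in_disc; lra|].
    assert (E' : ((G c - A) / H c0 c0 = 0)%C).
    { replace ((G c - A) / H c0 c0)%C with (c - (c - (G c - A) / H c0 c0))%C by ring.
      rewrite E. ring. }
    replace (G c) with ((G c - A) / H c0 c0 * H c0 c0 + A)%C by (field; auto).
    rewrite E'. ring.
Qed.

Theorem local_inverse : exists (cb : C -> C) (delta B : R),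
  0 < delta /\ cb (RtoC 0) = c0 /\ analytic_on cb (in_disc (RtoC 0) delta) /\
  forall A, in_disc (RtoC 0) delta A ->
    in_disc c0 inverse_radius (cb A) /\ G (cb A) = A /\
    (forall c, in_disc c0 inverse_radius c -> G c = A -> c = cb A) /\
    Cmod (cb A - (c0 + A / H c0 c0))%C <= B * Cmod A ^ 2.
Proof.
  set (delta := inverse_radius * h / 4).
  assert (Hdelta : 0 < delta).
  { assert (K := inverse_radius_pos). unfold delta. apply Rdiv_lt_0_compat; [|lra].
    now apply Rmult_lt_0_compat. }
  (* The branch is selected by the choice operator; expansiveness of G makes the selected point the
     only one. *)
  set (cb := fun A => epsilon (inhabits c0) (fun c => in_disc c0 inverse_radius c /\ G c = A)).
  assert (Hcb : forall A, in_disc (RtoC 0) delta A -> in_disc c0 inverse_radius (cb A) /\ G (cb A) = A).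
  { intros A HA. unfold cb. apply epsilon_spec. apply G_surjective.
    unfold in_disc in HA. now replace (A - 0)%C with A in HA by ring. }
  assert (Huniq : forall A c, in_disc (RtoC 0) delta A -> in_disc c0 inverse_radius c -> G c = A -> c = cb A).
  { intros A c HA Hc E. destruct (Hcb A HA) as [H1 H2].
    assert (K := G_expansive _ _ H1 Hc). rewrite E, H2 in K.
    replace (A - A)%C with (RtoC 0) in K by ring. rewrite Cmod_0, Rmult_0_r in K.
    assert (K' : Cmod (c - cb A)%C = 0) by (generalize (Cmod_ge_0 (c - cb A)%C); lra).
    apply Cmod_eq_0 in K'. replace c with (c - cb A + cb A)%C by ring. rewrite K'. ring. }
  exists cb, delta, (L / h * (2 / h) ^ 2). split; auto. split; [|split].
  - symmetry. apply Huniq; auto.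
    + now apply in_disc_center.
    + apply in_disc_center, inverse_radius_pos.
  - intros A HA. destruct (Hcb A HA) as [H1 H2].
    assert (Hlow := H_lower _ _ H1 H1).
    assert (Hne : forall c, in_disc c0 inverse_radius c -> H (cb A) c <> RtoC 0).
    { intros c Hc. apply Cmod_gt_0. generalize (H_lower _ _ H1 Hc). lra. }
    assert (Hd : 0 < delta - Cmod (A - 0)%C) by (unfold in_disc in HA; lra).
    (* Factoring G with base point [cb A] gives the difference quotient 1/H(cb A, cb A'). Replacing
       its second argument by [cb A] costs O(|A' - A|), so the branch is differentiable at every A
       of the disc and not only at 0. *)
    exists (/ H (cb A) (cb A))%C.
    apply Cderive_of_quadratic with (mkposreal _ Hd) (2 / h * L * (2 / h) * (2 / h)).
    simpl. intros A' HA'.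
    assert (HA1 : in_disc (RtoC 0) delta A').
    { unfold in_disc. eapply Rle_lt_trans; [apply (Cmod_triangle_minus _ A)|]. lra. }
    destruct (Hcb A' HA1) as [H3 H4].
    assert (E : (A' - A = (cb A' - cb A) * H (cb A) (cb A'))%C).
    { rewrite <- H2 at 1. rewrite <- H4 at 1. now apply G_factor; apply in_big. }
    replace (cb A' - cb A - (A' - A) * / H (cb A) (cb A))%C
      with ((cb A' - cb A) * (H (cb A) (cb A) - H (cb A) (cb A')) / H (cb A) (cb A))%C
      by (rewrite E; field; auto).
    assert (K1 := G_expansive _ _ H1 H3). rewrite H2, H4 in K1.
    assert (K2 : Cmod (H (cb A) (cb A) - H (cb A) (cb A'))%C <= L * (2 / h * Cmod (A' - A)%C)).
    { eapply Rle_trans; [apply H_lipschitz; auto|].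
      apply Rmult_le_compat_l; auto.
      replace (cb A - cb A)%C with (RtoC 0) by ring. rewrite Cmod_0, (Cmod_minus_sym (cb A)). lra. }
    rewrite Cmod_div, Cmod_mult by auto.
    assert (K3 : / Cmod (H (cb A) (cb A)) <= 2 / h).
    { replace (2 / h) with (/ (h / 2)) by (field; lra). apply Rinv_le_contravar; lra. }
    apply Rle_trans with ((2 / h * Cmod (A' - A)%C) * (L * (2 / h * Cmod (A' - A)%C)) * (2 / h));
      [|right; ring].
    apply Rmult_le_compat; auto.
    + apply Rmult_le_pos; apply Cmod_ge_0.
    + left. apply Rinv_0_lt_compat. lra.
    + apply Rmult_le_compat; auto; apply Cmod_ge_0.
  - intros A HA. destruct (Hcb A HA) as [H1 H2]. split; auto. split; auto. split; auto.
    replace (cb A - (c0 + A / H c0 c0))%C with (cb A - c0 - A / H c0 c0)%C by ring.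
    rewrite <- H2 at 2. eapply Rle_trans; [now apply G_linearization|].
    rewrite Rmult_assoc. apply Rmult_le_compat_l.
    { apply Rmult_le_pos; auto. left. now apply Rinv_0_lt_compat. }
    rewrite <- Rpow_mult_distr. apply pow_incr. split; [apply Cmod_ge_0|].
    generalize (G_expansive_center _ H1). now rewrite H2.
Qed.

End LocalInverse.

(** * Lipschitz dependence on the phase speed *)

(** Boundedness and Lipschitz continuity in the two speeds, uniformly along the path. The bound is
    included because products require it, and two speeds are carried because divided differences
    depend on two; quantities with fewer arguments ignore the others. The class is closed under ring
    operations, integration, and inversion away from 0. *)
Definition unif_lip (a b : R) (c0 : C) (r : R) (h : R -> C -> C -> C) : Prop :=
  exists B, 0 <= B /\ forall s, segment a b s -> forall c c' d d',
    in_disc c0 r c -> in_disc c0 r c' -> in_disc c0 r d -> in_disc c0 r d' ->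
    Cmod (h s c c') <= B /\
    Cmod (h s c c' - h s d d')%C <= B * (Cmod (c - d)%C + Cmod (c' - d')%C).

Section UnifLip.

Variables (a b : R) (c0 : C) (r : R).

Lemma unif_lip_ext (h k : R -> C -> C -> C) :
  (forall s c c', segment a b s -> in_disc c0 r c -> in_disc c0 r c' -> h s c c' = k s c c') ->
  unif_lip a b c0 r h -> unif_lip a b c0 r k.
Proof.
  intros E [B [HB H]]. exists B. split; auto. intros s Hs c c' d d' Hc Hc' Hd Hd'.
  rewrite <- !E by auto. auto.
Qed.

Lemma unif_lip_of_bounded (f : R -> C) B :
  (forall s, segment a b s -> Cmod (f s) <= B) -> unif_lip a b c0 r (fun s _ _ => f s).
Proof.
  intros H. exists (Rabs B). split; [apply Rabs_pos|].
  intros s Hs c c' d d' _ _ _ _. split.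
  - eapply Rle_trans; [apply H; auto | apply Rle_abs].
  - replace (f s - f s)%C with (RtoC 0) by ring. rewrite Cmod_0.
    apply Rmult_le_pos; [apply Rabs_pos | apply Rplus_le_le_0_compat; apply Cmod_ge_0].
Qed.

Lemma unif_lip_const (z : C) : unif_lip a b c0 r (fun _ _ _ => z).
Proof. apply unif_lip_of_bounded with (Cmod z). intros. lra. Qed.

Lemma in_disc_Cmod c : in_disc c0 r c -> Cmod c <= Cmod c0 + Rabs r.
Proof.
  unfold in_disc. intros Hc. replace c with (c0 + (c - c0))%C by ring.
  eapply Rle_trans; [apply Cmod_triangle|]. generalize (Rle_abs r). lra.
Qed.

Lemma unif_lip_swap (h : R -> C -> C -> C) :
  unif_lip a b c0 r h -> unif_lip a b c0 r (fun s c c' => h s c' c).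
Proof.
  intros [B [HB H]]. exists B. split; auto. intros s Hs c c' d d' Hc Hc' Hd Hd'.
  destruct (H s Hs c' c d' d Hc' Hc Hd' Hd) as [H1 H2]. split; auto.
  now rewrite (Rplus_comm (Cmod (c - d))).
Qed.

Lemma unif_lip_var : unif_lip a b c0 r (fun _ c _ => c).
Proof.
  exists (1 + Cmod c0 + Rabs r). generalize (Cmod_ge_0 c0) (Rabs_pos r). intros K1 K2.
  split; [lra|]. intros s _ c c' d d' Hc Hc' Hd Hd'. split.
  - generalize (in_disc_Cmod c Hc). lra.
  - rewrite <- (Rmult_1_l (Cmod (c - d)%C)) at 1.
    generalize (Cmod_ge_0 (c - d)%C) (Cmod_ge_0 (c' - d')%C). intros.
    apply Rmult_le_compat; lra.
Qed.

Lemma unif_lip_plus (h k : R -> C -> C -> C) : unif_lip a b c0 r h -> unif_lip a b c0 r k ->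
  unif_lip a b c0 r (fun s c c' => h s c c' + k s c c')%C.
Proof.
  intros [B [HB H]] [B' [HB' H']]. exists (B + B'). split; [lra|].
  intros s Hs c c' d d' Hc Hc' Hd Hd'.
  destruct (H s Hs c c' d d' Hc Hc' Hd Hd') as [H1 H2].
  destruct (H' s Hs c c' d d' Hc Hc' Hd Hd') as [H3 H4]. split.
  - eapply Rle_trans; [apply Cmod_triangle|]. lra.
  - replace (h s c c' + k s c c' - (h s d d' + k s d d'))%C
      with ((h s c c' - h s d d') + (k s c c' - k s d d'))%C by ring.
    eapply Rle_trans; [apply Cmod_triangle|]. lra.
Qed.

Lemma unif_lip_mult (h k : R -> C -> C -> C) : unif_lip a b c0 r h -> unif_lip a b c0 r k ->
  unif_lip a b c0 r (fun s c c' => h s c c' * k s c c')%C.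
Proof.
  intros [B [HB H]] [B' [HB' H']]. exists (2 * B * B').
  assert (HBB := Rmult_le_pos _ _ HB HB').
  split; [lra|].
  intros s Hs c c' d d' Hc Hc' Hd Hd'.
  destruct (H s Hs c c' d d' Hc Hc' Hd Hd') as [H1 H2].
  destruct (H s Hs d d' d d' Hd Hd' Hd Hd') as [H1' _].
  destruct (H' s Hs c c' d d' Hc Hc' Hd Hd') as [H3 H4]. split.
  - rewrite Cmod_mult. apply Rle_trans with (B * B'); [|lra].
    apply Rmult_le_compat; auto; apply Cmod_ge_0.
  - replace (h s c c' * k s c c' - h s d d' * k s d d')%C
      with ((h s c c' - h s d d') * k s c c' + h s d d' * (k s c c' - k s d d'))%C by ring.
    eapply Rle_trans; [apply Cmod_triangle|]. rewrite !Cmod_mult.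
    set (e := Cmod (c - d) + Cmod (c' - d')) in *.
    assert (Cmod (h s c c' - h s d d') * Cmod (k s c c') <= (B * e) * B')
      by (apply Rmult_le_compat; auto; apply Cmod_ge_0).
    assert (Cmod (h s d d') * Cmod (k s c c' - k s d d') <= B * (B' * e))
      by (apply Rmult_le_compat; auto; apply Cmod_ge_0).
    lra.
Qed.

Lemma unif_lip_opp (h : R -> C -> C -> C) : unif_lip a b c0 r h ->
  unif_lip a b c0 r (fun s c c' => - h s c c')%C.
Proof.
  intros H. apply (unif_lip_ext (fun s c c' => (- (1)) * h s c c')%C); [intros; ring|].
  apply unif_lip_mult; auto. apply unif_lip_const.
Qed.

Lemma unif_lip_minus (h k : R -> C -> C -> C) : unif_lip a b c0 r h -> unif_lip a b c0 r k ->
  unif_lip a b c0 r (fun s c c' => h s c c' - k s c c')%C.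
Proof. intros Hh Hk. apply unif_lip_plus; auto. now apply unif_lip_opp. Qed.

(** From 1/h - 1/h' = -(h - h')/(h h'), with both denominators bounded below by the same [m]. *)
Lemma unif_lip_inv (h : R -> C -> C -> C) m : 0 < m ->
  (forall s c c', segment a b s -> in_disc c0 r c -> in_disc c0 r c' -> m <= Cmod (h s c c')) ->
  unif_lip a b c0 r h -> unif_lip a b c0 r (fun s c c' => / h s c c')%C.
Proof.
  intros Hm Hl [B [HB H]]. exists (/ m + B * (/ m * / m)).
  assert (Hm' := Rinv_0_lt_compat _ Hm).
  assert (Hmm : 0 <= / m * / m) by (apply Rmult_le_pos; lra).
  assert (HBm := Rmult_le_pos _ _ HB Hmm).
  split; [lra|]. intros s Hs c c' d d' Hc Hc' Hd Hd'.
  assert (L1 := Hl s c c' Hs Hc Hc'). assert (L2 := Hl s d d' Hs Hd Hd').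
  assert (N1 : h s c c' <> RtoC 0) by (apply Cmod_gt_0; lra).
  assert (N2 : h s d d' <> RtoC 0) by (apply Cmod_gt_0; lra).
  destruct (H s Hs c c' d d' Hc Hc' Hd Hd') as [_ H2]. split.
  - rewrite Cmod_inv by auto.
    assert (/ Cmod (h s c c') <= / m) by (apply Rinv_le_contravar; auto). lra.
  - replace (/ h s c c' - / h s d d')%C
      with (- ((h s c c' - h s d d') * (/ h s c c' * / h s d d')))%C by (field; auto).
    rewrite Cmod_opp, !Cmod_mult, !Cmod_inv by auto.
    set (e := Cmod (c - d) + Cmod (c' - d')) in *.
    assert (He : 0 <= e) by (apply Rplus_le_le_0_compat; apply Cmod_ge_0).
    apply Rle_trans with ((B * e) * (/ m * / m)).
    + apply Rmult_le_compat; auto; try apply Cmod_ge_0.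
      * apply Rmult_le_pos; left; apply Rinv_0_lt_compat; lra.
      * apply Rmult_le_compat; try (left; apply Rinv_0_lt_compat; lra);
          apply Rinv_le_contravar; lra.
    + assert (0 <= / m * e) by (apply Rmult_le_pos; lra). lra.
Qed.

Lemma unif_lip_CRInt (h : R -> C -> C -> C) : a <= b ->
  (forall c c', in_disc c0 r c -> in_disc c0 r c' -> seg_cont a b (fun s => h s c c')) ->
  unif_lip a b c0 r h -> unif_lip a b c0 r (fun _ c c' => CRInt (fun s => h s c c') a b).
Proof.
  intros Hab Hc [B [HB H]]. exists ((b - a) * B). split; [apply Rmult_le_pos; lra|].
  intros s _ c c' d d' Hc1 Hc2 Hd1 Hd2. split.
  - apply CRInt_bound; auto. intros x Hx. now apply (H x Hx c c' d d').
  - rewrite <- CRInt_minus by auto. rewrite Rmult_assoc.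
    apply CRInt_bound; auto.
    + now apply seg_cont_minus; auto.
    + intros x Hx. now apply (H x Hx c c' d d').
Qed.

Lemma unif_lip_at (h : R -> C -> C -> C) t : segment a b t ->
  unif_lip a b c0 r h -> unif_lip a b c0 r (fun _ => h t).
Proof. intros Ht [B [HB H]]. exists B. split; auto. Qed.

Lemma unif_lip_le (h : R -> C -> C -> C) r' : r' <= r ->
  unif_lip a b c0 r h -> unif_lip a b c0 r' h.
Proof.
  intros Hr [B [HB H]]. exists B. split; auto. intros s Hs c c' d d' Hc Hc' Hd Hd'.
  apply H; auto; now apply in_disc_le with r'.
Qed.

(** Gronwall's inequality is used twice, starting from the data at [b]. Without forcing it bounds
    each solution. The difference of the solutions for two speeds solves the same system, forced by
    the difference of the coefficients times a bounded solution; that forcing is O(|c - d|), and so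
    is the difference. *)
Lemma linear_system_unif_lip (A K : R -> C -> C) (f q : C -> R -> C) : a <= b ->
  (forall c, in_disc c0 r c -> seg_cont a b (f c)) ->
  (forall c, in_disc c0 r c -> seg_cont a b (q c)) ->
  (forall c, in_disc c0 r c -> seg_derive a b (f c) (fun s => A s c * q c s)%C) ->
  (forall c, in_disc c0 r c -> seg_derive a b (q c) (fun s => K s c * f c s)%C) ->
  unif_lip a b c0 r (fun s c _ => A s c) -> unif_lip a b c0 r (fun s c _ => K s c) ->
  unif_lip a b c0 r (fun _ c _ => f c b) -> unif_lip a b c0 r (fun _ c _ => q c b) ->
  unif_lip a b c0 r (fun s c _ => f c s) /\ unif_lip a b c0 r (fun s c _ => q c s).
Proof.
  intros Hab Cf Cq Df Dq [N1 [HN1 HA]] [N2 [HN2 HK]] [M1 [HM1 Hf]] [M2 [HM2 Hq]].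
  assert (Hb : segment a b b) by (unfold segment; lra).
  set (N := N1 + N2). set (M := M1 + M2). set (G := exp ((2 * N + 1) * (b - a))).
  assert (HG : 0 < G) by apply exp_pos.
  set (B1 := 2 * (M + 0) * G).
  assert (HB1 : 0 <= B1) by (apply Rmult_le_pos; [unfold M|]; lra).
  assert (HA' : forall s c d, segment a b s -> in_disc c0 r c -> in_disc c0 r d ->
    Cmod (A s c) <= N /\ Cmod (A s c - A s d)%C <= N * Cmod (c - d)%C).
  { intros s c d Hs Hc Hd. destruct (HA s Hs c c d c Hc Hc Hd Hc) as [H1 H2].
    unfold N. split; [lra|]. eapply Rle_trans; [exact H2|].
    replace (c - c)%C with (RtoC 0) by ring. rewrite Cmod_0, Rplus_0_r.
    apply Rmult_le_compat_r; [apply Cmod_ge_0 | lra]. }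
  assert (HK' : forall s c d, segment a b s -> in_disc c0 r c -> in_disc c0 r d ->
    Cmod (K s c) <= N /\ Cmod (K s c - K s d)%C <= N * Cmod (c - d)%C).
  { intros s c d Hs Hc Hd. destruct (HK s Hs c c d c Hc Hc Hd Hc) as [H1 H2].
    unfold N. split; [lra|]. eapply Rle_trans; [exact H2|].
    replace (c - c)%C with (RtoC 0) by ring. rewrite Cmod_0, Rplus_0_r.
    apply Rmult_le_compat_r; [apply Cmod_ge_0 | lra]. }
  assert (HE : forall c d, in_disc c0 r c -> in_disc c0 r d ->
    Cmod (f c b) <= M /\ Cmod (q c b) <= M /\
    Cmod (f c b - f d b)%C <= M * Cmod (c - d)%C /\ Cmod (q c b - q d b)%C <= M * Cmod (c - d)%C).
  { intros c d Hc Hd. destruct (Hf b Hb c c d c Hc Hc Hd Hc) as [H1 H2].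
    destruct (Hq b Hb c c d c Hc Hc Hd Hc) as [H3 H4].
    replace (c - c)%C with (RtoC 0) in H2, H4 by ring. rewrite Cmod_0, Rplus_0_r in H2, H4.
    generalize (Cmod_ge_0 (c - d)%C). intros Hcd.
    assert (0 <= M1 * Cmod (c - d)) by now apply Rmult_le_pos.
    assert (0 <= M2 * Cmod (c - d)) by now apply Rmult_le_pos.
    unfold M. repeat split; lra. }
  assert (HN : 0 <= N) by (unfold N; lra).
  assert (Bd : forall c, in_disc c0 r c -> forall s, segment a b s ->
    Cmod (f c s) <= B1 /\ Cmod (q c s) <= B1).
  { intros c Hc s Hs.
    apply (gronwall_system a b (f c) (q c) (fun s => A s c * q c s)%C (fun s => K s c * f c s)%C
             N 0 M Hab (Cf c Hc) (Cq c Hc) (Df c Hc) (Dq c Hc) HN (Rle_refl 0)) with b; auto;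
      try apply (HE c c Hc Hc).
    - intros x Hx. rewrite Cmod_mult, Rplus_0_r. apply Rmult_le_compat_r; [apply Cmod_ge_0|].
      now apply (HA' x c c).
    - intros x Hx. rewrite Cmod_mult, Rplus_0_r. apply Rmult_le_compat_r; [apply Cmod_ge_0|].
      now apply (HK' x c c). }
  (* The forcing is delta = N |c - d| B1, the end data differ by at most M |c - d|, and the common
     factor |c - d| is taken out of the resulting bound. *)
  assert (Lip : forall c d, in_disc c0 r c -> in_disc c0 r d -> forall s, segment a b s ->
    Cmod (f c s - f d s)%C <= 2 * (M + N * B1) * G * Cmod (c - d)%C /\
    Cmod (q c s - q d s)%C <= 2 * (M + N * B1) * G * Cmod (c - d)%C).
  { intros c d Hc Hd s Hs.
    replace (2 * (M + N * B1) * G * Cmod (c - d)%C)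
      with (2 * (M * Cmod (c - d)%C + N * Cmod (c - d)%C * B1) * G) by ring.
    apply (gronwall_system a b (fun x => f c x - f d x)%C (fun x => q c x - q d x)%C
             (fun s => A s c * q c s - A s d * q d s)%C (fun s => K s c * f c s - K s d * f d s)%C
             N (N * Cmod (c - d)%C * B1) (M * Cmod (c - d)%C) Hab) with b; auto;
      try apply (HE c d Hc Hd).
    - apply seg_cont_minus; auto.
    - apply seg_cont_minus; auto.
    - intros x Hx. apply curve_derive_minus; [apply (Df c Hc) | apply (Df d Hd)]; auto.
    - intros x Hx. apply curve_derive_minus; [apply (Dq c Hc) | apply (Dq d Hd)]; auto.
    - apply Rmult_le_pos; auto. apply Rmult_le_pos; auto. apply Cmod_ge_0.
    - intros x Hx.
      replace (A x c * q c x - A x d * q d x)%C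
        with (A x c * (q c x - q d x) + (A x c - A x d) * q d x)%C by ring.
      eapply Rle_trans; [apply Cmod_triangle|]. rewrite !Cmod_mult.
      apply Rplus_le_compat; apply Rmult_le_compat; try apply Cmod_ge_0; try lra;
        try apply (HA' x c d); auto. now apply Bd.
    - intros x Hx.
      replace (K x c * f c x - K x d * f d x)%C
        with (K x c * (f c x - f d x) + (K x c - K x d) * f d x)%C by ring.
      eapply Rle_trans; [apply Cmod_triangle|]. rewrite !Cmod_mult.
      apply Rplus_le_compat; apply Rmult_le_compat; try apply Cmod_ge_0; try lra;
        try apply (HK' x c d); auto. now apply Bd. }
  set (B2 := 2 * (M + N * B1) * G) in *.
  assert (HB2 : 0 <= B2).
  { unfold B2. apply Rmult_le_pos; [|lra]. assert (0 <= N * B1) by now apply Rmult_le_pos.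
    unfold M; lra. }
  split; exists (B1 + B2); (split; [lra|]); intros s Hs c c' d d' Hc Hc' Hd Hd';
    destruct (Bd c Hc s Hs) as [K1 K2]; destruct (Lip c d Hc Hd s Hs) as [K3 K4];
    (split; [lra|]);
    generalize (Cmod_ge_0 (c - d)%C) (Cmod_ge_0 (c' - d')%C); intros P1 P2;
    assert (P3 := Rmult_le_pos _ _ HB1 P1); assert (P4 := Rmult_le_pos _ _ HB1 P2);
    assert (P5 := Rmult_le_pos _ _ HB2 P2); lra.
Qed.

End UnifLip.

(** X is assumed differentiable at the point only relative to a set Z that contains the curve
    nearby. This covers at once a holomorphic continuation, where Z is everything, and a stretch of
    path on the real axis, where only the real derivative of the profile is available. *)
Lemma curve_derive_chain (Z : C -> Prop) (X : C -> C) (g : R -> C) x (dX dg : C) :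
  (forall eps : posreal, exists d : posreal, forall z', Z z' -> Cmod (z' - g x)%C < d ->
     Cmod (X z' - X (g x) - (z' - g x) * dX)%C <= eps * Cmod (z' - g x)%C) ->
  curve_derive g x dg -> locally x (fun t => Z (g t)) ->
  curve_derive (fun t => X (g t)) x (dX * dg)%C.
Proof.
  intros HX Hg HZ. apply curve_derive_eps. intros eps.
  generalize (Cmod_ge_0 dg) (Cmod_ge_0 dX). intros K1 K2.
  assert (He1 : 0 < eps / (2 * (Cmod dg + 1)))
    by (apply Rdiv_lt_0_compat; [apply cond_pos | lra]).
  assert (He2 : 0 < eps / (2 * (Cmod dX + 1)))
    by (apply Rdiv_lt_0_compat; [apply cond_pos | lra]).
  destruct (HX (mkposreal _ He1)) as [d Hd]. simpl in Hd.
  assert (Hcont := proj1 (filterlim_Cmod (locally x) _ _) (curve_derive_cont _ _ _ Hg) d).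
  assert (Hg1 := proj1 (curve_derive_eps _ _ _) Hg (mkposreal 1 Rlt_0_1)).
  assert (Hg2 := proj1 (curve_derive_eps _ _ _) Hg (mkposreal _ He2)).
  simpl in Hg1, Hg2.
  generalize (filter_and _ _ (filter_and _ _ HZ Hcont) (filter_and _ _ Hg1 Hg2)).
  apply filter_imp. intros t [[Zt Ct] [D1 D2]].
  specialize (Hd _ Zt Ct).
  assert (Hlin : Cmod (g t - g x)%C <= (Cmod dg + 1) * Rabs (t - x)).
  { replace (g t - g x)%C with ((g t - g x - RtoC (t - x) * dg) + RtoC (t - x) * dg)%C by ring.
    eapply Rle_trans; [apply Cmod_triangle|]. rewrite Cmod_mult, Cmod_R. lra. }
  replace (X (g t) - X (g x) - RtoC (t - x) * (dX * dg))%C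
    with ((X (g t) - X (g x) - (g t - g x) * dX) + (g t - g x - RtoC (t - x) * dg) * dX)%C by ring.
  eapply Rle_trans; [apply Cmod_triangle|]. rewrite Cmod_mult.
  assert (S1 : eps / (2 * (Cmod dg + 1)) * Cmod (g t - g x)%C <= eps / 2 * Rabs (t - x)).
  { replace (eps / 2 * Rabs (t - x))
      with (eps / (2 * (Cmod dg + 1)) * ((Cmod dg + 1) * Rabs (t - x))) by (field; lra).
    apply Rmult_le_compat_l; lra. }
  assert (S2 : Cmod (g t - g x - RtoC (t - x) * dg) * Cmod dX <= eps / 2 * Rabs (t - x)).
  { replace (eps / 2 * Rabs (t - x))
      with ((eps / (2 * (Cmod dX + 1)) * Rabs (t - x)) * (Cmod dX + 1)) by (field; lra).
    apply Rmult_le_compat; try lra; apply Cmod_ge_0. }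
  lra.
Qed.

Lemma curve_derive_inv (f : R -> C) x (l : C) : f x <> RtoC 0 -> curve_derive f x l ->
  curve_derive (fun t => / f t)%C x (- / (f x * f x) * l)%C.
Proof.
  intros Hx Hf.
  assert (Hm := proj1 (Cmod_gt_0 _) Hx). set (m := Cmod (f x)) in *.
  assert (Hm2 : 0 < m / 2) by lra.
  apply (curve_derive_chain (fun _ => True) Cinv); auto.
  2: { apply filter_forall. auto. }
  intros eps.
  destruct (proj1 (Cderive_eps Cinv (f x) (- / (f x * f x))%C)) with eps as [d Hd].
  2: { exists d. auto. }
  (* The remainder is (z - w)^2/(z w^2) with w = [f x], and |z| >= m/2 on the disc of radius m/2
     around w. *)
  apply Cderive_of_quadratic with (mkposreal _ Hm2) (/ (m / 2 * (m * m))). simpl.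
  intros z Hz.
  assert (Hzm : m / 2 <= Cmod z).
  { assert (T : m <= Cmod z + Cmod (f x - z)%C).
    { unfold m. replace (f x) with (z + (f x - z))%C at 1 by ring. apply Cmod_triangle. }
    rewrite Cmod_minus_sym in T. lra. }
  assert (Hz0 : z <> RtoC 0) by (apply Cmod_gt_0; lra).
  replace (/ z - / f x - (z - f x) * - / (f x * f x))%C
    with (/ (z * (f x * f x)) * ((z - f x) * (z - f x)))%C by (field; auto).
  rewrite Cmod_mult, Cmod_inv, !Cmod_mult.
  2: { now repeat apply Cmult_neq_0. }
  fold m. rewrite Rmult_1_r.
  apply Rmult_le_compat_r; [apply Rmult_le_pos; apply Cmod_ge_0|].
  assert (0 < m * m) by now apply Rmult_lt_0_compat.
  apply Rinv_le_contravar.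
  - now apply Rmult_lt_0_compat.
  - apply Rmult_le_compat_r; lra.
Qed.

(** * The base flow along the path *)

Section AlongPath.

Variables (yb : R) (U : R -> R) (c0 : C) (r rho : R) (F : profile) (L : path).
Hypothesis yb_pos : 0 < yb.
Hypothesis path_causal : causal_path yb U c0 r rho F L.
Variables X dX : C -> C.
Hypothesis X_real : is_derive_on 0 yb (fun y => X (RtoC y)) (fun y => dX (RtoC y)).
Hypothesis X_holo : forall z, near_critical yb U c0 rho z ->
  @is_derive C_AbsRing C_NormedModule X z (dX z).

(* [Z] is the region the path visits near [s]: a neighbourhood of the point in
   the complex plane, or the real segment only. *)
Lemma profile_local_derivative s : segment 0 yb s ->
  exists Z : C -> Prop, within (segment 0 yb) (locally s) (fun t => Z (py L t)) /\
  forall eps : posreal, exists d : posreal, forall z', Z z' -> Cmod (z' - py L s)%C < d ->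
    Cmod (X z' - X (py L s) - (z' - py L s) * dX (py L s))%C <= eps * Cmod (z' - py L s)%C.
Proof.
  intros Hs. destruct (cc_region _ _ _ _ _ _ _ path_causal s Hs) as [Hn | Hr].
  - exists (fun _ => True). split; [apply filter_forall; auto|].
    intros eps. destruct (proj1 (Cderive_eps _ _ _) (X_holo _ Hn) eps) as [d Hd].
    exists d. auto.
  - exists (on_real_segment yb). split; auto.
    destruct (locally_singleton _ _ Hr Hs) as [y [Hy Ey]].
    intros eps. destruct (is_derive_on_eps _ _ _ _ y X_real Hy eps) as [d Hd].
    exists d. intros z' [y' [Hy' ->]]. rewrite Ey.
    rewrite <- RtoC_minus, Cmod_R. intros Hz. now apply Hd.
Qed.

Lemma profile_seg_cont : seg_cont 0 yb (fun s => X (py L s)).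
Proof.
  apply seg_cont_of_within; [lra|]. intros s Hs.
  destruct (profile_local_derivative s Hs) as [Z [HZ HX]].
  apply filterlim_Cmod; [apply within_filter, locally_filter|]. intros eps.
  destruct (HX (mkposreal 1 Rlt_0_1)) as [d Hd]. simpl in Hd.
  set (K := Cmod (dX (py L s)) + 1).
  assert (HK : 0 < K) by (unfold K; generalize (Cmod_ge_0 (dX (py L s))); lra).
  assert (Hm : 0 < Rmin d (eps / K)).
  { apply Rmin_pos; [apply cond_pos | apply Rdiv_lt_0_compat; auto; apply cond_pos]. }
  assert (Hc : seg_cont 0 yb (py L))
    by (eapply is_derive_on_cont; [lra | apply (cc_derive _ _ _ _ _ _ _ path_causal)]).
  assert (Hw : Filter (within (segment 0 yb) (locally s))) by (apply within_filter, locally_filter).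
  assert (H0yb : 0 <= yb) by lra.
  generalize (filter_and _ _ HZ (seg_cont_at 0 yb (py L) s H0yb Hc Hs (mkposreal _ Hm))).
  apply filter_imp. simpl. intros t [Zt Ht].
  assert (Ht1 := Rlt_le_trans _ _ _ Ht (Rmin_l _ _)).
  assert (Ht2 := Rlt_le_trans _ _ _ Ht (Rmin_r _ _)).
  specialize (Hd _ Zt Ht1).
  replace (X (py L t) - X (py L s))%C
    with ((X (py L t) - X (py L s) - (py L t - py L s) * dX (py L s))
          + (py L t - py L s) * dX (py L s))%C by ring.
  eapply Rle_lt_trans; [apply Cmod_triangle|]. rewrite Cmod_mult.
  apply Rle_lt_trans with (K * Cmod (py L t - py L s)%C); [unfold K; lra|].
  apply Rmult_lt_compat_l with (r := K) in Ht2; auto.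
  replace (K * (eps / K)) with (pos eps) in Ht2 by (field; lra). exact Ht2.
Qed.

Lemma profile_seg_derive :
  seg_derive 0 yb (fun s => X (py L s)) (fun s => dX (py L s) * pdy L s)%C.
Proof.
  intros s Hs. assert (Hs' : segment 0 yb s) by (unfold segment; lra).
  destruct (profile_local_derivative s Hs') as [Z [HZ HX]].
  apply curve_derive_chain with Z; auto.
  - apply (is_derive_on_derive 0 yb); auto. apply (cc_derive _ _ _ _ _ _ _ path_causal).
  - assert (H2 : locally s (fun t => 0 < t < yb)).
    { apply filter_and; [apply (open_gt 0) | apply (open_lt yb)]; lra. }
    unfold within in HZ. generalize (filter_and _ _ HZ H2). apply filter_imp.
    intros t [H3 H4]. apply H3. unfold segment; lra.
Qed.

End AlongPath.

(** * The Rayleigh equation *)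

Lemma Cderive_locally_lipschitz (f : C -> C) (z : C) :
  @ex_derive C_AbsRing C_NormedModule f z ->
  exists (d : posreal) (K : R), 0 < K /\
    forall z', Cmod (z' - z)%C < d -> Cmod (f z' - f z)%C <= K * Cmod (z' - z)%C.
Proof.
  intros [l Hl]. destruct (proj1 (Cderive_eps _ _ _) Hl (mkposreal 1 Rlt_0_1)) as [d Hd].
  exists d, (Cmod l + 1). split; [generalize (Cmod_ge_0 l); lra|].
  intros z' Hz. specialize (Hd z' Hz). simpl in Hd.
  replace (f z' - f z)%C with ((f z' - f z - (z' - z) * l) + (z' - z) * l)%C by ring.
  eapply Rle_trans; [apply Cmod_triangle|]. rewrite Cmod_mult. lra.
Qed.

Section Rayleigh.

(** From here on the base flow is seen through the path parameter only: [u] and [tt] are U and T on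
    the path, [u1] and [t1] their derivatives in y, and [w] is dy/ds. *)
Variables (alpha M yb : R) (c0 : C) (r : R).
Variables (u u1 tt t1 w : R -> C) (gamma : C -> C) (P dP : C -> R -> C).
Hypothesis alpha_pos : 0 < alpha.
Hypothesis yb_pos : 0 < yb.
Hypothesis r_pos : 0 < r.
Hypothesis u_cont : seg_cont 0 yb u.
Hypothesis tt_cont : seg_cont 0 yb tt.
Hypothesis w_cont : seg_cont 0 yb w.
Hypothesis u_derive : seg_derive 0 yb u (fun s => u1 s * w s)%C.
Hypothesis tt_derive : seg_derive 0 yb tt (fun s => t1 s * w s)%C.
Hypothesis u_noncritical : forall s c, segment 0 yb s -> in_disc c0 r c -> u s <> c.
Hypothesis tt_neq_0 : forall s, segment 0 yb s -> tt s <> RtoC 0.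
Hypothesis u_0 : u 0 = RtoC 0.
Hypothesis u_yb : u yb = RtoC 1.
Hypothesis tt_yb : tt yb = RtoC 1.
Hypothesis P_cont : forall c, in_disc c0 r c -> seg_cont 0 yb (P c).
Hypothesis dP_cont : forall c, in_disc c0 r c -> seg_cont 0 yb (dP c).
Hypothesis P_derive : forall c, in_disc c0 r c -> seg_derive 0 yb (P c) (fun s => dP c s * w s)%C.
Hypothesis dP_derive : forall c, in_disc c0 r c -> seg_derive 0 yb (dP c) (fun s =>
  ((RtoC 2 * u1 s / (u s - c) - t1 s / tt s) * dP c s
   + RtoC alpha ^ 2 * (1 - RtoC M ^ 2 * (u s - c) ^ 2 / tt s) * P c s) * w s)%C.
Hypothesis P_yb : forall c, in_disc c0 r c -> P c yb = RtoC 1.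
Hypothesis dP_yb : forall c, in_disc c0 r c -> dP c yb = (- gamma c)%C.
Hypothesis gamma_branched : gamma_branch alpha M c0 r gamma.

Let yb_nonneg : 0 <= yb.
Proof. lra. Qed.

Let seg_0 : segment 0 yb 0.
Proof. unfold segment; lra. Qed.

Let seg_yb : segment 0 yb yb.
Proof. unfold segment; lra. Qed.

Lemma u_minus_neq_0 s c : segment 0 yb s -> in_disc c0 r c -> (u s - c <> 0)%C.
Proof.
  intros Hs Hc E. apply (u_noncritical s c Hs Hc).
  replace (u s) with (u s - c + c)%C by ring. rewrite E. ring.
Qed.

(** If [u s] lay in the disc of radius r it could itself be taken as the excluded c, so it is at
    distance at least r from [c0]. Halving the disc leaves a margin r/2, uniform in s. *)
Lemma u_minus_lower s c : segment 0 yb s -> in_disc c0 (r / 2) c -> r / 2 <= Cmod (u s - c)%C.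
Proof.
  intros Hs Hc.
  assert (H : r <= Cmod (u s - c0)%C).
  { destruct (Rle_lt_dec r (Cmod (u s - c0)%C)) as [|Hlt]; auto.
    now destruct (u_noncritical s (u s) Hs Hlt). }
  unfold in_disc in Hc. generalize (Cmod_triangle_minus (u s) c c0). lra.
Qed.

(* Using [T p' / (U - c)^2] rather than [p'] as the second unknown removes the
   derivatives of the base flow from the system. *)
Definition flux (c : C) (s : R) : C := (tt s * dP c s * / ((u s - c) * (u s - c)))%C.

Definition coefA (s : R) (c : C) : C := ((u s - c) * (u s - c) * / tt s * w s)%C.

(** The coefficient of (Phi p')' = alpha^2 (Phi - M^2) p with Phi = T/(U - c)^2, multiplied by
    dy/ds. *)
Definition coefK (s : R) (c : C) : C :=
  (RtoC alpha * RtoC alpha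
   * (tt s * (/ (u s - c) * / (u s - c)) - RtoC M * RtoC M) * w s)%C.

Lemma dP_flux s c : segment 0 yb s -> in_disc c0 r c ->
  dP c s = ((u s - c) * (u s - c) * / tt s * flux c s)%C.
Proof.
  intros Hs Hc. unfold flux.
  assert (Hu := u_minus_neq_0 s c Hs Hc). assert (Ht := tt_neq_0 s Hs). field. auto.
Qed.

Lemma flux_cont c : in_disc c0 r c -> seg_cont 0 yb (flux c).
Proof.
  intros Hc. unfold flux. apply seg_cont_mult; [now apply seg_cont_mult; auto|].
  apply seg_cont_inv; auto.
  - intros s Hs. apply Cmult_neq_0; now apply u_minus_neq_0.
  - apply seg_cont_mult; apply seg_cont_minus; auto; apply seg_cont_const.
Qed.

Lemma P_derive_flux c : in_disc c0 r c ->
  seg_derive 0 yb (P c) (fun s => coefA s c * flux c s)%C.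
Proof.
  intros Hc s Hs. eapply curve_derive_eq; [now apply P_derive|]. cbv beta.
  rewrite (dP_flux s c); [unfold coefA; ring| |auto]. unfold segment; lra.
Qed.

Lemma flux_derive c : in_disc c0 r c ->
  seg_derive 0 yb (flux c) (fun s => coefK s c * P c s)%C.
Proof.
  intros Hc s Hs. assert (Hs' : segment 0 yb s) by (unfold segment; lra).
  assert (Hu := u_minus_neq_0 s c Hs' Hc). assert (Ht := tt_neq_0 s Hs').
  eapply curve_derive_eq.
  - unfold flux. apply curve_derive_mult.
    + apply curve_derive_mult; [now apply tt_derive | now apply dP_derive].
    + apply curve_derive_inv; [now apply Cmult_neq_0|].
      apply (curve_derive_mult (fun t => u t - c)%C (fun t => u t - c)%C);
        (apply curve_derive_minus; [now apply u_derive | apply curve_derive_const]).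
  - unfold coefK. simpl Cpow. field. auto.
Qed.

(** * The Wronskian of two solutions and its divided difference *)

Definition divdiff_gamma (c c' : C) : C :=
  (RtoC alpha * RtoC alpha * (RtoC M * RtoC M) * (RtoC 2 - c - c') * / (gamma c + gamma c'))%C.

(** The Wronskian at y_b is gamma(c)/(1 - c)^2 - gamma(c')/(1 - c')^2; this is its quotient by c' -
    c, written without that denominator so that it makes sense for c = c'. On the diagonal it gives
    the term I_infty, up to sign. *)
Definition wr_boundary (c c' : C) : C :=
  (- ((divdiff_gamma c c' * ((1 - c) * (1 - c)) + gamma c * (RtoC 2 - c - c'))
      * / ((1 - c) * (1 - c) * ((1 - c') * (1 - c')))))%C.

(** The derivative of the Wronskian divided by c' - c, using (u - c)^2 - (u - c')^2 = (c' - c)(2u -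
    c - c'). For c = c' the first factors reduce to 2T/(u - c)^3, as in I. *)
Definition wr_density (s : R) (c c' : C) : C :=
  (tt s * (RtoC 2 * u s - c - c')
   * / ((u s - c) * (u s - c) * ((u s - c') * (u s - c')))
   * (dP c s * dP c' s + RtoC alpha * RtoC alpha * (P c s * P c' s)) * w s)%C.

Lemma wr_density_cont c c' : in_disc c0 r c -> in_disc c0 r c' ->
  seg_cont 0 yb (fun s => wr_density s c c').
Proof.
  intros Hc Hc'. unfold wr_density.
  repeat match goal with
  | |- seg_cont _ _ (fun _ => (_ * _)%C) => apply seg_cont_mult
  | |- seg_cont _ _ (fun _ => (_ + _)%C) => apply seg_cont_plus
  | |- seg_cont _ _ (fun _ => (_ - _)%C) => apply seg_cont_minus
  | |- seg_cont _ _ (fun _ => (/ _)%C) => apply seg_cont_inv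
  end; auto using seg_cont_const.
  intros s Hs.
  assert (Hu := u_minus_neq_0 s c Hs Hc). assert (Hu' := u_minus_neq_0 s c' Hs Hc').
  repeat apply Cmult_neq_0; auto.
Qed.

Lemma gamma_sqr c : in_disc c0 r c -> (gamma c * gamma c =
  RtoC alpha * RtoC alpha * (1 - RtoC M * RtoC M * ((1 - c) * (1 - c))))%C.
Proof.
  intros Hc. destruct gamma_branched as [_ [H _]]. specialize (H c Hc). simpl Cpow in H.
  replace (gamma c * gamma c)%C with (gamma c * (gamma c * 1))%C by ring. rewrite H. ring.
Qed.

Lemma one_minus_neq_0 c : in_disc c0 r c -> (1 - c <> 0)%C.
Proof. intros Hc. rewrite <- u_yb. now apply u_minus_neq_0. Qed.

(** The branch relation gives gamma(c')^2 - gamma(c)^2 = alpha^2 M^2 (c' - c)(2 - c - c'), which is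
    then divided by gamma(c) + gamma(c'). *)
Lemma divdiff_gamma_spec c c' : in_disc c0 r c -> in_disc c0 r c' ->
  (gamma c + gamma c' <> 0)%C -> (gamma c' - gamma c = (c' - c) * divdiff_gamma c c')%C.
Proof.
  intros Hc Hc' Hn.
  replace (gamma c' - gamma c)%C
    with ((gamma c' * gamma c' - gamma c * gamma c) * / (gamma c + gamma c'))%C by (field; auto).
  rewrite !gamma_sqr by auto. unfold divdiff_gamma. ring.
Qed.

Lemma wronskian_identity c c' : in_disc c0 r c -> in_disc c0 r c' ->
  (gamma c + gamma c' <> 0)%C ->
  (flux c' 0%R * P c 0%R - flux c 0%R * P c' 0%R
   = (c' - c) * (wr_boundary c c' - CRInt (fun s => wr_density s c c') 0 yb))%C.
Proof.
  intros Hc Hc' Hn.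
  set (W := fun s => (flux c' s * P c s - flux c s * P c' s)%C).
  assert (HW : CRInt (fun s => (c' - c) * wr_density s c c')%C 0 yb = (W yb - W 0)%C).
  { apply seg_FTC; auto.
    - apply seg_cont_minus; apply seg_cont_mult; auto; now apply flux_cont.
    - intros s Hs. assert (Hs' : segment 0 yb s) by (unfold segment; lra).
      assert (Hu := u_minus_neq_0 s c Hs' Hc). assert (Hu' := u_minus_neq_0 s c' Hs' Hc').
      assert (Ht := tt_neq_0 s Hs').
      eapply curve_derive_eq.
      + exact (curve_derive_minus _ _ _ _ _
          (curve_derive_mult _ _ _ _ _ (flux_derive c' Hc' s Hs) (P_derive c Hc s Hs))
          (curve_derive_mult _ _ _ _ _ (flux_derive c Hc s Hs) (P_derive c' Hc' s Hs))).
      + unfold wr_density, coefK, flux. field. auto.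
    - apply seg_cont_mult; [apply seg_cont_const | now apply wr_density_cont]. }
  rewrite CRInt_scal in HW by (auto; now apply wr_density_cont).
  assert (E : W yb = ((c' - c) * wr_boundary c c')%C).
  { unfold W, flux. rewrite !P_yb, !dP_yb, u_yb, tt_yb by auto.
    assert (H1 := one_minus_neq_0 c Hc). assert (H2 := one_minus_neq_0 c' Hc').
    unfold wr_boundary.
    replace (gamma c') with ((gamma c' - gamma c) + gamma c)%C by ring.
    rewrite divdiff_gamma_spec by auto. field. auto. }
  change (W 0 = (c' - c) * (wr_boundary c c' - CRInt (fun s => wr_density s c c') 0 yb))%C.
  replace (W 0) with (W yb - (W yb - W 0))%C by ring. rewrite <- HW, E. ring.
Qed.

Lemma gamma_0_neq_0 : gamma c0 <> RtoC 0.
Proof.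
  destruct gamma_branched as [_ [_ H]]. intros E. rewrite E in H. simpl in H. lra.
Qed.

(** Differentiability at [c0] alone keeps gamma within g/2 of gamma(c0) on a small disc, with g =
    |gamma(c0)|. Hence |gamma(c) + gamma(c')| >= 2g - g and |gamma(c)| <= 3g/2. *)
Lemma gamma_local : exists r1, 0 < r1 /\ r1 <= r / 2 /\
  forall c c', in_disc c0 r1 c -> in_disc c0 r1 c' ->
    Cmod (gamma c0) <= Cmod (gamma c + gamma c')%C /\ Cmod (gamma c) <= 2 * Cmod (gamma c0).
Proof.
  destruct gamma_branched as [Han _].
  destruct (Cderive_locally_lipschitz gamma c0 (Han c0 (in_disc_center _ _ r_pos))) as [d [K [HK Hd]]].
  assert (Hg := proj1 (Cmod_gt_0 _) gamma_0_neq_0). set (g := Cmod (gamma c0)) in *.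
  exists (Rmin (Rmin d (r / 2)) (g / (2 * K))).
  assert (Hq : 0 < g / (2 * K)) by (apply Rdiv_lt_0_compat; lra).
  split; [|split].
  - apply Rmin_pos; auto. apply Rmin_pos; [apply cond_pos | lra].
  - eapply Rle_trans; [apply Rmin_l | apply Rmin_r].
  - assert (Hn : forall c, in_disc c0 (Rmin (Rmin d (r / 2)) (g / (2 * K))) c ->
      Cmod (gamma c - gamma c0)%C <= g / 2).
    { unfold in_disc. intros c Hc.
      assert (Hc1 := Rlt_le_trans _ _ _ Hc (Rmin_l _ _)).
      assert (Hc2 := Rlt_le_trans _ _ _ Hc (Rmin_r _ _)).
      assert (Hc3 := Rlt_le_trans _ _ _ Hc1 (Rmin_l _ _)).
      eapply Rle_trans; [now apply Hd|].
      replace (g / 2) with (K * (g / (2 * K))) by (field; lra).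
      apply Rmult_le_compat_l; lra. }
    intros c c' Hc Hc'. assert (K1 := Hn c Hc). assert (K2 := Hn c' Hc'). split.
    + assert (T : 2 * g <= Cmod (gamma c + gamma c')%C
                  + Cmod ((gamma c - gamma c0) + (gamma c' - gamma c0))%C).
      { replace (2 * g) with (Cmod (RtoC 2 * gamma c0)%C)
          by (rewrite Cmod_mult, Cmod_R, Rabs_pos_eq by lra; reflexivity).
        replace (RtoC 2 * gamma c0)%C with ((gamma c + gamma c')
          - ((gamma c - gamma c0) + (gamma c' - gamma c0)))%C by ring.
        unfold Cminus at 1. eapply Rle_trans; [apply Cmod_triangle|]. rewrite Cmod_opp. lra. }
      generalize (Cmod_triangle (gamma c - gamma c0)%C (gamma c' - gamma c0)%C). lra.
    + replace (gamma c) with ((gamma c - gamma c0) + gamma c0)%C by ring.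
      eapply Rle_trans; [apply Cmod_triangle|]. fold g. lra.
Qed.

Section SmallDisc.

Variable r1 : R.
Hypothesis r1_le : r1 <= r / 2.
Hypothesis gamma_near : forall c c', in_disc c0 r1 c -> in_disc c0 r1 c' ->
  Cmod (gamma c0) <= Cmod (gamma c + gamma c')%C /\ Cmod (gamma c) <= 2 * Cmod (gamma c0).

Let disc_half c : in_disc c0 r1 c -> in_disc c0 (r / 2) c.
Proof. now apply in_disc_le. Qed.

Let disc_r c : in_disc c0 r1 c -> in_disc c0 r c.
Proof. apply in_disc_le. lra. Qed.

Let g_pos : 0 < Cmod (gamma c0).
Proof. exact (proj1 (Cmod_gt_0 _) gamma_0_neq_0). Qed.

Lemma gamma_sum_neq_0 c c' : in_disc c0 r1 c -> in_disc c0 r1 c' -> (gamma c + gamma c' <> 0)%C.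
Proof.
  intros Hc Hc'. apply Cmod_gt_0. generalize (proj1 (gamma_near c c' Hc Hc')). lra.
Qed.

Let UL := unif_lip 0 yb c0 r1.

Let UL_const z : UL (fun _ _ _ => z) := unif_lip_const 0 yb c0 r1 z.
Let UL_c : UL (fun _ c _ => c) := unif_lip_var 0 yb c0 r1.
Let UL_c' : UL (fun _ _ c' => c') := unif_lip_swap 0 yb c0 r1 _ UL_c.

Let UL_curve f : seg_cont 0 yb f -> UL (fun s _ _ => f s).
Proof.
  intros Hf. destruct (seg_cont_bounded 0 yb f yb_nonneg Hf) as [B [_ HB]].
  now apply unif_lip_of_bounded with B.
Qed.

Let UL_u : UL (fun s _ _ => u s) := UL_curve u u_cont.
Let UL_tt_inv : UL (fun s _ _ => / tt s)%C.
Proof. apply (UL_curve (fun s => / tt s)%C). now apply seg_cont_inv. Qed.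

Let UL_u_inv : UL (fun s c _ => / (u s - c))%C.
Proof.
  apply (unif_lip_inv 0 yb c0 r1 (fun s c _ => u s - c)%C (r / 2)); [lra | |].
  - intros s c _ Hs Hc _. now apply u_minus_lower; auto.
  - now apply unif_lip_minus.
Qed.

Let UL_u_inv' : UL (fun s _ c' => / (u s - c'))%C := unif_lip_swap 0 yb c0 r1 _ UL_u_inv.

Ltac unif_lip_tac :=
  repeat match goal with
  | |- UL (fun _ _ _ => (_ * _)%C) => apply unif_lip_mult
  | |- UL (fun _ _ _ => (_ + _)%C) => apply unif_lip_plus
  | |- UL (fun _ _ _ => (_ - _)%C) => apply unif_lip_minus
  | |- UL (fun _ _ _ => (- _)%C) => apply unif_lip_opp
  | |- unif_lip _ _ _ _ ?h => change (UL h)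
  end; auto.

(** The Lipschitz bound comes from the divided difference, whose denominator is at least g; a bound
    on the derivative of gamma over the disc is thereby avoided. *)
Lemma gamma_unif_lip : UL (fun _ c _ => gamma c).
Proof.
  set (g := Cmod (gamma c0)) in *.
  set (q := fun c d => (RtoC alpha * RtoC alpha * (RtoC M * RtoC M) * (RtoC 2 - c - d))%C).
  assert (Hq : UL (fun _ c d => q c d)) by (unfold q; unif_lip_tac).
  destruct Hq as [B [HB Hq]].
  assert (HBg : 0 <= B * / g) by (apply Rmult_le_pos; auto; left; now apply Rinv_0_lt_compat).
  exists (2 * g + B * / g). split; [lra|].
  intros s Hs c c' d d' Hc Hc' Hd Hd'. split.
  - generalize (proj2 (gamma_near c c Hc Hc)). fold g. lra.
  - rewrite (divdiff_gamma_spec d c) by (auto; now apply gamma_sum_neq_0).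
    unfold divdiff_gamma. fold (q d c). rewrite !Cmod_mult, Cmod_inv by now apply gamma_sum_neq_0.
    destruct (Hq s Hs d c d c Hd Hc Hd Hc) as [Hb _].
    assert (Hs' : Cmod (q d c) * / Cmod (gamma d + gamma c)%C <= B * / g).
    { apply Rmult_le_compat; auto.
      - apply Cmod_ge_0.
      - left. apply Rinv_0_lt_compat. apply Cmod_gt_0. now apply gamma_sum_neq_0.
      - apply Rinv_le_contravar; auto. now apply gamma_near. }
    generalize (Cmod_ge_0 (c - d)%C) (Cmod_ge_0 (c' - d')%C). intros P1 P2.
    apply Rle_trans with (Cmod (c - d)%C * (B * / g)).
    + apply Rmult_le_compat_l; auto.
    + assert (0 <= B * / g * Cmod (c' - d')%C) by now apply Rmult_le_pos.
      assert (0 <= g * (Cmod (c - d)%C + Cmod (c' - d')%C)) by (apply Rmult_le_pos; lra).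
      lra.
Qed.

Let UL_gamma := gamma_unif_lip.
Let UL_gamma' : UL (fun _ _ c' => gamma c') := unif_lip_swap 0 yb c0 r1 _ UL_gamma.

Lemma divdiff_gamma_unif_lip : UL (fun _ c c' => divdiff_gamma c c').
Proof.
  unfold divdiff_gamma. unif_lip_tac.
  apply (unif_lip_inv 0 yb c0 r1 (fun _ c c' => gamma c + gamma c')%C (Cmod (gamma c0))); auto.
  - intros _ c c' _ Hc Hc'. now apply gamma_near.
  - unif_lip_tac.
Qed.

Let UL_one : UL (fun _ c _ => / (1 - c))%C.
Proof.
  apply (unif_lip_ext 0 yb c0 r1 (fun _ c _ => / (u yb - c))%C).
  - intros. now rewrite u_yb.
  - exact (unif_lip_at 0 yb c0 r1 (fun s c _ => / (u s - c))%C yb seg_yb UL_u_inv).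
Qed.

Let UL_one' : UL (fun _ _ c' => / (1 - c'))%C := unif_lip_swap 0 yb c0 r1 _ UL_one.

Lemma wr_boundary_unif_lip : UL (fun _ c c' => wr_boundary c c').
Proof.
  assert (Hdd := divdiff_gamma_unif_lip).
  apply (unif_lip_ext 0 yb c0 r1 (fun _ c c' =>
    - ((divdiff_gamma c c' * ((1 - c) * (1 - c)) + gamma c * (RtoC 2 - c - c'))
       * (/ (1 - c) * / (1 - c) * (/ (1 - c') * / (1 - c')))))%C).
  - intros _ c c' _ Hc Hc'. unfold wr_boundary.
    assert (H1 := one_minus_neq_0 c (disc_r c Hc)). assert (H2 := one_minus_neq_0 c' (disc_r c' Hc')).
    field. auto.
  - unif_lip_tac.
Qed.

Lemma solution_unif_lip : UL (fun s c _ => P c s) /\ UL (fun s c _ => flux c s).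
Proof.
  apply (linear_system_unif_lip 0 yb c0 r1 coefA coefK P flux yb_nonneg).
  - auto.
  - intros c Hc. apply flux_cont; auto.
  - intros c Hc. apply P_derive_flux; auto.
  - intros c Hc. apply flux_derive; auto.
  - unfold coefA. unif_lip_tac.
  - unfold coefK. unif_lip_tac.
  - apply (unif_lip_ext 0 yb c0 r1 (fun _ _ _ => RtoC 1)); [|apply UL_const].
    intros. symmetry. auto.
  - apply (unif_lip_ext 0 yb c0 r1 (fun _ c _ => - gamma c * (/ (1 - c) * / (1 - c)))%C);
      [|unif_lip_tac].
    intros s c _ _ Hc _. unfold flux. rewrite tt_yb, u_yb, dP_yb by auto.
    assert (H1 := one_minus_neq_0 c (disc_r c Hc)). field. auto.
Qed.

Lemma dP_unif_lip : UL (fun s c _ => dP c s).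
Proof.
  apply (unif_lip_ext 0 yb c0 r1 (fun s c _ => (u s - c) * (u s - c) * / tt s * flux c s)%C).
  - intros s c _ Hs Hc _. symmetry. apply dP_flux; auto.
  - destruct solution_unif_lip. unif_lip_tac.
Qed.

Lemma wr_density_unif_lip : UL (fun s c c' => wr_density s c c').
Proof.
  destruct solution_unif_lip as [HP _]. assert (HdP := dP_unif_lip).
  assert (HP' : UL (fun s _ c' => P c' s)) by exact (unif_lip_swap 0 yb c0 r1 _ HP).
  assert (HdP' : UL (fun s _ c' => dP c' s)) by exact (unif_lip_swap 0 yb c0 r1 _ HdP).
  apply (unif_lip_ext 0 yb c0 r1 (fun s c c' =>
    tt s * (RtoC 2 * u s - c - c')
    * (/ (u s - c) * / (u s - c) * (/ (u s - c') * / (u s - c')))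
    * (dP c s * dP c' s + RtoC alpha * RtoC alpha * (P c s * P c' s)) * w s)%C).
  - intros s c c' Hs Hc Hc'. unfold wr_density.
    assert (H1 := u_minus_neq_0 s c Hs (disc_r c Hc)).
    assert (H2 := u_minus_neq_0 s c' Hs (disc_r c' Hc')). field. auto.
  - unif_lip_tac.
Qed.

(** The divided difference of the Wronskian at the wall; on the diagonal at [c0] it is -I for the
    eigenfunction P(.;c0). *)
Definition wr_total (c c' : C) : C :=
  (wr_boundary c c' - CRInt (fun s => wr_density s c c') 0 yb)%C.

Lemma wr_total_unif_lip : UL (fun _ c c' => wr_total c c').
Proof.
  unfold wr_total. apply unif_lip_minus; [apply wr_boundary_unif_lip|].
  apply unif_lip_CRInt; auto; [|apply wr_density_unif_lip].
  intros c c' Hc Hc'. apply wr_density_cont; auto.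
Qed.

(* The wall admittance for which [c] is an eigenvalue. *)
Definition admittance (c : C) : C :=
  (Ci * / RtoC alpha * (c * (flux c 0%R * / P c 0%R)))%C.

(** With R = q(0)/p(0), this comes from c' R(c') - c R(c) = (c' - c) R(c') + c (R(c') - R(c)); the
    last difference is the Wronskian at the wall divided by p(0) for both speeds. *)
Definition admittance_slope (c c' : C) : C :=
  (Ci * / RtoC alpha *
   (flux c' 0%R * / P c' 0%R + c * (wr_total c c' * (/ P c 0%R * / P c' 0%R))))%C.

Lemma admittance_factor c c' : in_disc c0 r1 c -> in_disc c0 r1 c' ->
  P c 0 <> RtoC 0 -> P c' 0 <> RtoC 0 ->
  (admittance c' - admittance c = (c' - c) * admittance_slope c c')%C.
Proof.
  intros Hc Hc' H H'. unfold admittance, admittance_slope.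
  assert (E := wronskian_identity c c' (disc_r c Hc) (disc_r c' Hc') (gamma_sum_neq_0 c c' Hc Hc')).
  fold (wr_total c c') in E.
  assert (E2 : (flux c' 0%R * / P c' 0%R - flux c 0%R * / P c 0%R
     = (c' - c) * wr_total c c' * (/ P c 0%R * / P c' 0%R))%C).
  { rewrite <- E. field. auto. }
  replace (flux c 0%R * / P c 0%R)%C with
    (flux c' 0%R * / P c' 0%R - (flux c' 0%R * / P c' 0%R - flux c 0%R * / P c 0%R))%C by ring.
  rewrite E2. ring.
Qed.

End SmallDisc.

(** If p and p' both vanished at the wall, then so would q, and Gronwall's inequality run from the
    wall would give P(y_b) = 0 instead of 1. *)
Lemma P_wall_neq_0 : dP c0 0 = RtoC 0 -> P c0 0 <> RtoC 0.
Proof.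
  intros HdP HP. assert (Hc0 := in_disc_center c0 r r_pos).
  assert (Hf : flux c0 0 = RtoC 0) by (unfold flux; rewrite HdP; ring).
  destruct (seg_cont_bounded 0 yb (fun s => coefA s c0) yb_nonneg) as [B1 [HB1 HA]].
  { unfold coefA. apply seg_cont_mult; auto. apply seg_cont_mult; [|now apply seg_cont_inv].
    apply seg_cont_mult; apply seg_cont_minus; auto using seg_cont_const. }
  destruct (seg_cont_bounded 0 yb (fun s => coefK s c0) yb_nonneg) as [B2 [HB2 HK]].
  { unfold coefK. apply seg_cont_mult; auto. apply seg_cont_mult; [apply seg_cont_const|].
    apply seg_cont_minus; [|apply seg_cont_const]. apply seg_cont_mult; auto.
    assert (Hi : seg_cont 0 yb (fun s => / (u s - c0))%C).
    { apply seg_cont_inv; auto.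
      - intros s Hs. now apply u_minus_neq_0.
      - apply seg_cont_minus; auto using seg_cont_const. }
    now apply seg_cont_mult. }
  destruct (gronwall_system 0 yb (P c0) (flux c0) _ _ (B1 + B2) 0 0 yb_nonneg
    (P_cont c0 Hc0) (flux_cont c0 Hc0) (P_derive_flux c0 Hc0) (flux_derive c0 Hc0)) with 0 yb
    as [H _]; auto; try lra.
  - intros s Hs. rewrite Cmod_mult, Rplus_0_r. apply Rmult_le_compat_r; [apply Cmod_ge_0|].
    generalize (HA s Hs). lra.
  - intros s Hs. rewrite Cmod_mult, Rplus_0_r. apply Rmult_le_compat_r; [apply Cmod_ge_0|].
    generalize (HK s Hs). lra.
  - rewrite HP, Cmod_0. lra.
  - rewrite Hf, Cmod_0. lra.
  - rewrite P_yb, Cmod_1 in H by auto. rewrite Rplus_0_r, Rmult_0_r, Rmult_0_l in H. lra.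
Qed.

Lemma admittance_lipschitz_slope : dP c0 0 = RtoC 0 ->
  exists r2 L B, 0 < r2 /\ r2 <= r / 2 /\ 0 <= L /\
  (forall c, in_disc c0 r2 c -> P c 0 <> RtoC 0 /\ Cmod (P c 0) <= B) /\
  (forall c c', in_disc c0 r2 c -> in_disc c0 r2 c' ->
     (admittance c' - admittance c = (c' - c) * admittance_slope c c')%C) /\
  (forall c c' d d', in_disc c0 r2 c -> in_disc c0 r2 c' -> in_disc c0 r2 d -> in_disc c0 r2 d' ->
     Cmod (admittance_slope c c' - admittance_slope d d')%C
       <= L * (Cmod (c - d)%C + Cmod (c' - d')%C)).
Proof.
  intros HdP.
  destruct gamma_local as [r1 [Hr1 [Hr1r Hg]]].
  destruct (solution_unif_lip r1 Hr1r Hg) as [HP HQ].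
  assert (HT := wr_total_unif_lip r1 Hr1r Hg).
  assert (Hp0 := proj1 (Cmod_gt_0 _) (P_wall_neq_0 HdP)).
  set (m := Cmod (P c0 0)) in *.
  assert (HP0 := unif_lip_at 0 yb c0 r1 (fun s c _ => P c s) 0 seg_0 HP).
  assert (HQ0 := unif_lip_at 0 yb c0 r1 (fun s c _ => flux c s) 0 seg_0 HQ).
  generalize HP0. intros [B [HB HBP]].
  assert (Hr3 : 0 < m / (2 * (B + 1))) by (apply Rdiv_lt_0_compat; lra).
  (* Over this radius the Lipschitz bound on P(0;c) allows a change of at most m/2, so |P(0;c)| >=
     m/2 and the reciprocal is uniformly Lipschitz. *)
  set (r2 := Rmin r1 (m / (2 * (B + 1)))).
  assert (Hr2 : 0 < r2) by now apply Rmin_pos.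
  assert (Hr21 : r2 <= r1) by apply Rmin_l.
  assert (Hlow : forall c, in_disc c0 r2 c -> m / 2 <= Cmod (P c 0)).
  { intros c Hc. assert (Hc1 := in_disc_le c0 r2 r1 c Hr21 Hc).
    assert (Hc01 := in_disc_center c0 r1 Hr1).
    destruct (HBP 0 seg_0 c0 c0 c c0 Hc01 Hc01 Hc1 Hc01) as [_ H].
    replace (c0 - c0)%C with (RtoC 0) in H by ring. rewrite Cmod_0, Rplus_0_r in H.
    unfold in_disc in Hc. assert (Hc2 := Rlt_le_trans _ _ _ Hc (Rmin_r _ _)).
    rewrite Cmod_minus_sym in Hc2.
    assert (H2 : B * Cmod (c0 - c)%C <= m / 2).
    { replace (m / 2) with ((B + 1) * (m / (2 * (B + 1)))) by (field; lra).
      apply Rmult_le_compat; try lra. apply Cmod_ge_0. }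
    assert (T : m <= Cmod (P c0 0 - P c 0)%C + Cmod (P c 0)).
    { unfold m. replace (P c0 0) with ((P c0 0%R - P c 0%R) + P c 0%R)%C at 1 by ring.
      apply Cmod_triangle. }
    lra. }
  assert (Hn0 : forall c, in_disc c0 r2 c -> P c 0 <> RtoC 0).
  { intros c Hc. apply Cmod_gt_0. generalize (Hlow c Hc). lra. }
  assert (Hinv : unif_lip 0 yb c0 r2 (fun _ c _ => / P c 0%R)%C).
  { apply (unif_lip_inv 0 yb c0 r2 (fun _ c _ => P c 0) (m / 2)); [lra | |].
    - intros _ c _ _ Hc _. auto.
    - now apply unif_lip_le with r1. }
  assert (Hinv' := unif_lip_swap 0 yb c0 r2 _ Hinv).
  assert (HQ' := unif_lip_swap 0 yb c0 r2 _ (unif_lip_le 0 yb c0 r1 _ r2 Hr21 HQ0)).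
  assert (HS : unif_lip 0 yb c0 r2 (fun _ c c' => admittance_slope c c')).
  { unfold admittance_slope.
    apply unif_lip_mult; [apply unif_lip_const|].
    apply unif_lip_plus; apply unif_lip_mult; auto.
    - apply unif_lip_var.
    - apply unif_lip_mult; [now apply unif_lip_le with r1 | now apply unif_lip_mult]. }
  destruct HS as [L [HL HS]].
  exists r2, L, B. split; auto. split; [lra|]. split; auto. split; [|split].
  - intros c Hc. split; auto.
    assert (Hc1 := in_disc_le c0 r2 r1 c Hr21 Hc). now apply (HBP 0 seg_0 c c c c).
  - intros c c' Hc Hc'. apply (admittance_factor r1 Hr1r Hg); auto; now apply in_disc_le with r2.
  - intros c c' d d' Hc Hc' Hd Hd'. now apply (HS 0 seg_0).
Qed.

(** M is eliminated through alpha^2 M^2 = (alpha^2 - gamma^2)/(1 - c0)^2. The two parts then combine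
    as (alpha^2 - gamma^2)/gamma + 2 gamma = (alpha^2 + gamma^2)/gamma, the numerator in I_infty. *)
Lemma wr_boundary_diag : wr_boundary c0 c0 =
  (- (RtoC 2 * / ((1 - c0) * (1 - c0) * (1 - c0))
      * ((gamma c0 * gamma c0 + RtoC alpha * RtoC alpha) * / (RtoC 2 * gamma c0))))%C.
Proof.
  assert (Hc0 := in_disc_center c0 r r_pos).
  assert (H1 := one_minus_neq_0 c0 Hc0). assert (Hg := gamma_0_neq_0).
  assert (E : (RtoC alpha * RtoC alpha * (RtoC M * RtoC M)
     = (RtoC alpha * RtoC alpha - gamma c0 * gamma c0) * / ((1 - c0) * (1 - c0)))%C).
  { rewrite gamma_sqr by auto. field. auto. }
  assert (H2 : RtoC 2 <> RtoC 0) by (intros E'; apply RtoC_inj in E'; lra).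
  assert (H3 : (gamma c0 + gamma c0 <> 0)%C).
  { replace (gamma c0 + gamma c0)%C with (RtoC 2 * gamma c0)%C by ring. now apply Cmult_neq_0. }
  unfold wr_boundary, divdiff_gamma. rewrite E.
  replace (gamma c0 + gamma c0)%C with (RtoC 2 * gamma c0)%C by ring.
  field. auto.
Qed.

(** The eigenfunction is k P(.;c0). Its I scales with k^2, as does p0(0)^2, so K does not depend on
    the normalization. *)
Lemma norm_integral_wr_total (k : C) :
  (CRInt (fun s => RtoC 2 * tt s / (u s - c0) ^ 3
      * ((k * dP c0 s) ^ 2 + RtoC alpha ^ 2 * (k * P c0 s) ^ 2) * w s)%C 0 yb
   + RtoC 2 / (1 - c0) ^ 3
     * ((gamma c0 ^ 2 + RtoC alpha ^ 2) * (k * P c0 yb) ^ 2 / (RtoC 2 * gamma c0))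
   = - (k * k * wr_total c0 c0))%C.
Proof.
  assert (Hc0 := in_disc_center c0 r r_pos).
  assert (E : CRInt (fun s => RtoC 2 * tt s / (u s - c0) ^ 3
      * ((k * dP c0 s) ^ 2 + RtoC alpha ^ 2 * (k * P c0 s) ^ 2) * w s)%C 0 yb
    = (k * k * CRInt (fun s => wr_density s c0 c0) 0 yb)%C).
  { rewrite <- CRInt_scal by (auto; now apply wr_density_cont).
    apply (@RInt_ext C_R_CompleteNormedModule). intros s.
    rewrite Rmin_left, Rmax_right by lra. intros Hs.
    assert (Hs' : segment 0 yb s) by (unfold segment; lra).
    assert (Hu := u_minus_neq_0 s c0 Hs' Hc0).
    (* The equality is restated at type [C], where [field] finds its structure. *)
    match goal with |- @eq _ ?x ?y => change (@eq C x y) end.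
    unfold wr_density. simpl Cpow. field. auto. }
  rewrite E. unfold wr_total. rewrite wr_boundary_diag, P_yb by auto.
  assert (H1 := one_minus_neq_0 c0 Hc0). assert (Hg := gamma_0_neq_0).
  assert (H2 : RtoC 2 <> RtoC 0) by (intros E'; apply RtoC_inj in E'; lra).
  simpl Cpow. field. auto.
Qed.

(** * The dispersion function in terms of the admittance *)

Lemma disc_neq_0 c : in_disc c0 r c -> c <> RtoC 0.
Proof. intros Hc E. apply (u_noncritical 0 c seg_0 Hc). now rewrite u_0, E. Qed.

Lemma Ci_sqr : (Ci * Ci = - (1))%C.
Proof. apply injective_projections; simpl; ring. Qed.

Lemma Ci_neq_0 : Ci <> RtoC 0.
Proof. intros E. apply (f_equal snd) in E. simpl in E. lra. Qed.

Let alpha_neq_0 : RtoC alpha <> RtoC 0.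
Proof. intros E. apply RtoC_inj in E. lra. Qed.

(** Since U = 0 at the wall, P'(0) = c^2 q(0)/T_w. The prefactor is a product of nonzero quantities,
    so the zeros of D(., A) are the solutions of G(c) = A. *)
Lemma dispersion_admittance (Tw : R) c A : Tw <> 0 -> tt 0 = RtoC Tw ->
  in_disc c0 r c -> P c 0 <> RtoC 0 ->
  (dispersion alpha Tw P dP c A
   = - (Ci * RtoC alpha * P c 0%R * c * / RtoC Tw) * (admittance c - A))%C.
Proof.
  intros HTw E Hc HP. unfold dispersion, admittance.
  assert (HT : RtoC Tw <> RtoC 0) by (intros E'; apply RtoC_inj in E'; auto).
  assert (Hc' := disc_neq_0 c Hc).
  rewrite (dP_flux 0 c seg_0 Hc), u_0, E.
  transitivity (- (Ci * Ci) * (c * c * / RtoC Tw * flux c 0%R)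
                + Ci * RtoC alpha * c * A / RtoC Tw * P c 0%R)%C.
  - rewrite Ci_sqr. field. auto.
  - field. auto.
Qed.

Lemma admittance_slope_diag : dP c0 0 = RtoC 0 ->
  admittance_slope c0 c0
  = (Ci * / RtoC alpha * (c0 * (wr_total c0 c0 * (/ P c0 0%R * / P c0 0%R))))%C.
Proof. intros HdP. unfold admittance_slope, flux. rewrite HdP. ring. Qed.

Lemma admittance_c0 : dP c0 0 = RtoC 0 -> admittance c0 = RtoC 0.
Proof. intros HdP. unfold admittance, flux. rewrite HdP. ring. Qed.

(** Simplicity is used in contrapositive form. With H(c0, c0) = 0, G(c) = (c - c0)(H(c0, c) - H(c0,
    c0)) is O(|c - c0|^2), and D(c, 0) is G(c) times a bounded factor. *)
Lemma dispersion_degenerate (Tw : R) : Tw <> 0 -> tt 0 = RtoC Tw -> dP c0 0 = RtoC 0 ->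
  admittance_slope c0 c0 = RtoC 0 ->
  @is_derive C_AbsRing C_NormedModule (fun c => dispersion alpha Tw P dP c (RtoC 0)) c0 (RtoC 0).
Proof.
  intros HTw E HdP Hs.
  destruct (admittance_lipschitz_slope HdP) as [r2 [L [B [Hr2 [Hr2r [HL [HP [HG HS]]]]]]]].
  assert (Hc02 := in_disc_center c0 r2 Hr2).
  (* A bound for the modulus of the prefactor i alpha P(0;c) c/T_w over the small disc. *)
  set (N := alpha * B * (Cmod c0 + Rabs r2) * Cmod (/ RtoC Tw)%C).
  apply Cderive_of_quadratic with (mkposreal r2 Hr2) (N * L). simpl. intros c Hc.
  assert (Hcr : in_disc c0 r c) by (apply in_disc_le with r2; [lra | exact Hc]).
  destruct (HP c Hc) as [HPc HBc]. destruct (HP c0 Hc02) as [HP0 _].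
  rewrite !(dispersion_admittance Tw) by (auto; now apply in_disc_center).
  rewrite admittance_c0 by auto.
  assert (Ea : admittance c = ((c - c0) * (admittance_slope c0 c - admittance_slope c0 c0))%C).
  { rewrite Hs. generalize (HG c0 c Hc02 Hc). rewrite admittance_c0 by auto.
    replace (admittance c - 0)%C with (admittance c) by ring. intros ->. ring. }
  rewrite Ea.
  match goal with |- Cmod ?z <= _ =>
    replace z with ((Ci * RtoC alpha * P c 0%R * c * / RtoC Tw)
      * ((c - c0) * - (admittance_slope c0 c - admittance_slope c0 c0)))%C by ring end.
  rewrite Cmod_mult. replace (N * L * (Cmod (c - c0) * (Cmod (c - c0) * 1)))
    with (N * (Cmod (c - c0) * (L * Cmod (c - c0)))) by ring.
  apply Rmult_le_compat; try apply Cmod_ge_0.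
  - rewrite !Cmod_mult, Cmod_Ci, Cmod_R, Rabs_pos_eq, Rmult_1_l by lra. unfold N.
    apply Rmult_le_compat_r; [apply Cmod_ge_0|].
    apply Rmult_le_compat; try apply Cmod_ge_0.
    + apply Rmult_le_pos; [lra | apply Cmod_ge_0].
    + apply Rmult_le_compat_l; lra.
    + now apply in_disc_Cmod.
  - rewrite Cmod_mult, Cmod_opp. apply Rmult_le_compat_l; [apply Cmod_ge_0|].
    eapply Rle_trans; [now apply HS|].
    replace (c0 - c0)%C with (RtoC 0) by ring. rewrite Cmod_0. lra.
Qed.

End Rayleigh.

(** |Im z| <= |z|, so the error of the growth rate is at most alpha times that of the eigenvalue;
    the factor 1 + alpha lets one constant serve both. *)
Lemma growth_rate_linearization (alpha B x : R) (z K a c0 : C) : 0 < alpha -> 0 <= x ->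
  Cmod (z - (c0 + K * a))%C <= B * x ->
  Cmod (z - (c0 + K * a))%C <= Rabs B * (1 + alpha) * x /\
  Rabs (growth_rate alpha z - growth_rate alpha c0 - alpha * Im (K * a)%C)
    <= Rabs B * (1 + alpha) * x.
Proof.
  intros Ha Hx H. unfold growth_rate.
  assert (HB : B * x <= Rabs B * x) by (apply Rmult_le_compat_r; auto; apply Rle_abs).
  assert (HB' : 0 <= Rabs B * x) by (apply Rmult_le_pos; auto; apply Rabs_pos).
  assert (HB2 : 0 <= alpha * (Rabs B * x)) by (apply Rmult_le_pos; lra).
  split; [lra|].
  replace (alpha * Im z - alpha * Im c0 - alpha * Im (K * a)%C)
    with (alpha * Im (z - (c0 + K * a))%C) by (unfold Im, Cminus, Cplus, Copp, Cmult; simpl; ring).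
  rewrite Rabs_mult, (Rabs_pos_eq alpha) by lra.
  assert (Hi : Rabs (Im (z - (c0 + K * a))%C) <= Cmod (z - (c0 + K * a))%C).
  { eapply Rle_trans; [apply Rmax_r | apply Rmax_Cmod]. }
  apply Rle_trans with (alpha * (Rabs B * x)); [|lra].
  apply Rmult_le_compat_l; lra.
Qed.

(** * The eigenvalue branch and speed-dependent wall laws *)

Section Perturbation.

Variables (D : C -> C -> C) (N G : C -> C) (H : C -> C -> C).
Variables (alpha r : R) (c0 K : C) (r2 L : R).
Hypothesis alpha_pos : 0 < alpha.
Hypothesis r2_pos : 0 < r2.
Hypothesis r2_le : r2 <= r.
Hypothesis L_nonneg : 0 <= L.
Hypothesis D_factor : forall c A, in_disc c0 r2 c -> (D c A = N c * (G c - A))%C.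
Hypothesis N_neq_0 : forall c, in_disc c0 r2 c -> N c <> RtoC 0.
Hypothesis G_c0 : G c0 = RtoC 0.
Hypothesis G_factor : forall c c', in_disc c0 r2 c -> in_disc c0 r2 c' ->
  (G c' - G c = (c' - c) * H c c')%C.
Hypothesis H_lipschitz : forall c c' d d', in_disc c0 r2 c -> in_disc c0 r2 c' ->
  in_disc c0 r2 d -> in_disc c0 r2 d' ->
  Cmod (H c c' - H d d')%C <= L * (Cmod (c - d)%C + Cmod (c' - d')%C).
Hypothesis H_c0 : H c0 c0 <> RtoC 0.
Hypothesis K_spec : K = (/ H c0 c0)%C.

Let r1 := inverse_radius H c0 r2 L.

Let r1_pos : 0 < r1.
Proof. now apply inverse_radius_pos. Qed.

Let r1_le : r1 <= r2.
Proof. apply inverse_radius_le. Qed.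

Lemma D_zero_iff c A : in_disc c0 r2 c -> D c A = RtoC 0 <-> G c = A.
Proof.
  intros Hc. rewrite D_factor by auto. split.
  - intros E. destruct (Ceq_dec (G c) A) as [|Hne]; auto.
    destruct (Cmult_neq_0 (N c) (G c - A)%C); auto.
    intros E'. apply Hne. replace (G c) with (G c - A + A)%C by ring. rewrite E'. ring.
  - intros ->. ring.
Qed.

Lemma eigenvalue_branch :
  exists (cb : C -> C) (delta r1 : R),
    0 < delta /\ 0 < r1 <= r /\ cb (RtoC 0) = c0 /\
    analytic_on cb (in_disc (RtoC 0) delta) /\
    (forall A, in_disc (RtoC 0) delta A ->
       in_disc c0 r1 (cb A) /\ D (cb A) A = RtoC 0 /\
       (forall c, in_disc c0 r1 c -> D c A = RtoC 0 -> c = cb A)) /\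
    exists B : R, forall A, in_disc (RtoC 0) delta A ->
       Cmod (cb A - (c0 + K * A))%C <= B * Cmod A ^ 2 /\
       Rabs (growth_rate alpha (cb A) - growth_rate alpha (cb (RtoC 0)) - alpha * Im (K * A)%C)
          <= B * Cmod A ^ 2.
Proof.
  destruct (local_inverse G H c0 r2 L r2_pos L_nonneg G_c0 G_factor H_lipschitz H_c0)
    as [cb [delta [B [Hdelta [Hcb0 [Han Hcb]]]]]].
  exists cb, delta, r1. split; auto. split; [lra|]. split; auto. split; auto. split.
  - intros A HA. destruct (Hcb A HA) as [H1 [H2 [H3 _]]].
    split; auto. split.
    + apply D_zero_iff; auto. now apply in_disc_le with r1.
    + intros c Hc HD. apply H3; auto. apply D_zero_iff; auto. now apply in_disc_le with r1.
  - exists (Rabs B * (1 + alpha)). intros A HA. rewrite Hcb0.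
    apply growth_rate_linearization; auto; [apply pow2_ge_0|].
    destruct (Hcb A HA) as [_ [_ [_ H4]]].
    replace (K * A)%C with (A / H c0 c0)%C by (rewrite K_spec; unfold Cdiv; ring). exact H4.
Qed.

(** An eigenvalue for the law solves G(c) = eps W(c). Expansiveness gives c - c0 = O(eps), so
    replacing W(c) by W(c0) changes the right-hand side by eps O(|c - c0|) = O(eps^2), the order of
    the linearization error of G. *)
Lemma eigenvalue_wall_law (W : C -> C) :
  (exists r2, 0 < r2 /\ analytic_on W (in_disc c0 r2)) ->
  exists B eta r1 : R, 0 < eta /\ 0 < r1 <= r /\
    forall eps c, in_disc (RtoC 0) eta eps -> in_disc c0 r1 c ->
      D c (eps * W c)%C = RtoC 0 ->
      Cmod (c - (c0 + K * (eps * W c0)))%C <= B * Cmod eps ^ 2 /\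
      Rabs (growth_rate alpha c - growth_rate alpha c0 - alpha * Im (K * (eps * W c0))%C)
         <= B * Cmod eps ^ 2.
Proof.
  intros [rW [HrW HW]].
  destruct (Cderive_locally_lipschitz W c0 (HW c0 (in_disc_center _ _ HrW))) as [d [Kw [HKw Hd]]].
  set (r3 := Rmin r1 d).
  assert (Hr3 : 0 < r3) by (apply Rmin_pos; auto; apply cond_pos).
  assert (Hr31 : r3 <= r1) by apply Rmin_l.
  assert (Hr3d : r3 <= d) by apply Rmin_r.
  set (h := Cmod (H c0 c0)).
  assert (Hh : 0 < h) by exact (proj1 (Cmod_gt_0 _) H_c0).
  (* [w0] bounds |W| on the disc, [E] bounds |c - c0|/|eps|, and [B] adds the linearization error of
     G to the effect of the variation of W. *)
  set (w0 := Cmod (W c0) + Kw * d).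
  set (E := 2 / h * w0).
  set (B := L / h * E ^ 2 + / h * (Kw * E)).
  exists (Rabs B * (1 + alpha)), 1, r3. split; [lra|]. split; [lra|].
  intros eps c _ Hc HD.
  apply growth_rate_linearization; auto; [apply pow2_ge_0|].
  assert (Hc1 : in_disc c0 r1 c) by now apply in_disc_le with r3.
  assert (HG : G c = (eps * W c)%C).
  { apply D_zero_iff; auto. now apply in_disc_le with r1. }
  assert (Hcd : Cmod (c - c0)%C < d) by (unfold in_disc in Hc; lra).
  assert (Hdw := Hd c Hcd).
  assert (Pe := Cmod_ge_0 eps). assert (Pc := Cmod_ge_0 (c - c0)%C).
  assert (Hw : Cmod (W c) <= w0).
  { replace (W c) with (W c0 + (W c - W c0))%C by ring.
    eapply Rle_trans; [apply Cmod_triangle|]. unfold w0.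
    assert (Kw * Cmod (c - c0)%C <= Kw * d) by (apply Rmult_le_compat_l; lra). lra. }
  assert (Hhi : 0 < 2 / h) by (apply Rdiv_lt_0_compat; lra).
  assert (Hhi' : 0 < / h) by now apply Rinv_0_lt_compat.
  assert (Hcc : Cmod (c - c0)%C <= E * Cmod eps).
  { eapply Rle_trans; [now apply (G_expansive_center G H c0 r2 L)|].
    fold h. rewrite HG, Cmod_mult.
    replace (E * Cmod eps) with (2 / h * (Cmod eps * w0)) by (unfold E; ring).
    apply Rmult_le_compat_l; [lra|]. now apply Rmult_le_compat_l. }
  replace (c - (c0 + K * (eps * W c0)))%C
    with ((c - c0 - G c / H c0 c0) + / H c0 c0 * (eps * (W c - W c0)))%C
    by (rewrite HG, K_spec; unfold Cdiv; ring).
  eapply Rle_trans; [apply Cmod_triangle|].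
  assert (S1 : Cmod (c - c0 - G c / H c0 c0)%C <= L / h * E ^ 2 * Cmod eps ^ 2).
  { eapply Rle_trans; [now apply (G_linearization G H c0 r2 L)|].
    fold h. rewrite Rmult_assoc. apply Rmult_le_compat_l.
    - apply Rmult_le_pos; lra.
    - rewrite <- Rpow_mult_distr. now apply pow_incr. }
  assert (S2 : Cmod (/ H c0 c0 * (eps * (W c - W c0)))%C <= / h * (Kw * E) * Cmod eps ^ 2).
  { rewrite !Cmod_mult, Cmod_inv by auto. fold h.
    replace (/ h * (Kw * E) * Cmod eps ^ 2)
      with (/ h * (Cmod eps * (Kw * (E * Cmod eps)))) by ring.
    apply Rmult_le_compat_l; [lra|]. apply Rmult_le_compat_l; auto.
    eapply Rle_trans; [exact Hdw|]. apply Rmult_le_compat_l; lra. }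
  unfold B. lra.
Qed.

End Perturbation.

Theorem theorem1 :
  forall (alpha M yb : R) (U T : R -> R) (c0 : C) (r rho : R)
    (F : profile) (L : path) (gamma : C -> C) (P dP : C -> R -> C) (k : C),
  (0 < alpha)%R -> (0 < M)%R -> (0 < r)%R -> (0 < rho)%R ->
  base_flow yb U T ->
  is_continuation yb U T c0 rho F ->
  causal_path yb U c0 r rho F L ->
  (forall c : C, in_disc c0 r c -> (1 - RtoC M ^ 2 * (1 - c) ^ 2 <> 0)%C) ->
  gamma_branch alpha M c0 r gamma ->
  (forall c : C, in_disc c0 r c ->
     rayleigh_solution alpha M yb F L c (P c) (dP c) /\
     P c yb = RtoC 1 /\ dP c yb = (- gamma c)%C) ->
  let D := dispersion alpha (T 0%R) P dP in
  D c0 (RtoC 0) = RtoC 0 ->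
  C_derive (fun c => D c (RtoC 0)) c0 <> RtoC 0 ->
  k <> RtoC 0 ->
  let p0 := fun s => (k * P c0 s)%C in
  let dp0 := fun s => (k * dP c0 s)%C in
  let K := sensitivity alpha yb F L c0 (gamma c0) p0 dp0 in
  let sigma := growth_rate alpha in
  (exists (cb : C -> C) (delta r1 : R),
    (0 < delta)%R /\ (0 < r1 <= r)%R /\
    cb (RtoC 0) = c0 /\
    analytic_on cb (in_disc (RtoC 0) delta) /\
    (forall A : C, in_disc (RtoC 0) delta A ->
       in_disc c0 r1 (cb A) /\ D (cb A) A = RtoC 0 /\
       (forall c : C, in_disc c0 r1 c -> D c A = RtoC 0 -> c = cb A)) /\
    exists B : R, forall A : C, in_disc (RtoC 0) delta A ->
       (Cmod (cb A - (c0 + K * A)) <= B * Cmod A ^ 2)%R /\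
       (Rabs (sigma (cb A) - sigma (cb (RtoC 0)) - alpha * Im (K * A)%C)
          <= B * Cmod A ^ 2)%R) /\
  (* wall law A = eps * W(c) *)
  (forall W : C -> C,
    (exists r2 : R, (0 < r2)%R /\ analytic_on W (in_disc c0 r2)) ->
    exists B eta r1 : R, (0 < eta)%R /\ (0 < r1 <= r)%R /\
    forall eps c : C, in_disc (RtoC 0) eta eps -> in_disc c0 r1 c ->
      D c (eps * W c)%C = RtoC 0 ->
      (Cmod (c - (c0 + K * (eps * W c0))) <= B * Cmod eps ^ 2)%R /\
      (Rabs (sigma c - sigma c0 - alpha * Im (K * (eps * W c0))%C)
         <= B * Cmod eps ^ 2)%R).
Proof.
  intros alpha M yb U T c0 r rho F L gamma P dP k Halpha HM Hr Hrho HB HF HL _ Hgamma HP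
    D HD0 HDc Hk p0 dp0 K sigma.
  set (u := fun s => pU F (py L s)). set (u1 := fun s => pdU F (py L s)).
  set (tt := fun s => pT F (py L s)). set (t1 := fun s => pdT F (py L s)).
  set (w := pdy L).
  assert (Hyb := bf_yb _ _ _ HB).
  assert (Hyb' : 0 <= yb) by lra.
  assert (S0 : segment 0 yb 0) by (unfold segment; lra).
  assert (Sy : segment 0 yb yb) by (unfold segment; lra).
  assert (uc : seg_cont 0 yb u)
    by exact (profile_seg_cont yb U c0 r rho F L Hyb HL (pU F) (pdU F)
                (ic_dU _ _ _ _ _ _ HF) (ic_holoU _ _ _ _ _ _ HF)).
  assert (tc : seg_cont 0 yb tt)
    by exact (profile_seg_cont yb U c0 r rho F L Hyb HL (pT F) (pdT F)
                (ic_dT _ _ _ _ _ _ HF) (ic_holoT _ _ _ _ _ _ HF)).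
  assert (wc : seg_cont 0 yb w)
    by (apply seg_cont_of_within; auto; apply (cc_C1 _ _ _ _ _ _ _ HL)).
  assert (ud : seg_derive 0 yb u (fun s => u1 s * w s)%C)
    by exact (profile_seg_derive yb U c0 r rho F L HL (pU F) (pdU F)
                (ic_dU _ _ _ _ _ _ HF) (ic_holoU _ _ _ _ _ _ HF)).
  assert (td : seg_derive 0 yb tt (fun s => t1 s * w s)%C)
    by exact (profile_seg_derive yb U c0 r rho F L HL (pT F) (pdT F)
                (ic_dT _ _ _ _ _ _ HF) (ic_holoT _ _ _ _ _ _ HF)).
  assert (un : forall s c, segment 0 yb s -> in_disc c0 r c -> u s <> c)
    by exact (cc_noncritical _ _ _ _ _ _ _ HL).
  (* Off the continuation region the point is real, where T > 0; inside it the continuation is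
     nonzero by assumption. *)
  assert (tn : forall s, segment 0 yb s -> tt s <> RtoC 0).
  { intros s Hs. unfold tt. destruct (cc_region _ _ _ _ _ _ _ HL s Hs) as [Hn | Hreal].
    - now apply (ic_Tneq0 _ _ _ _ _ _ HF).
    - destruct (locally_singleton _ _ Hreal Hs) as [y [Hy ->]].
      rewrite (ic_T _ _ _ _ _ _ HF) by auto. intros E. apply RtoC_inj in E.
      generalize (bf_Tpos _ _ _ HB y (proj1 Hy)). lra. }
  assert (u0 : u 0 = RtoC 0).
  { unfold u. rewrite (cc_start _ _ _ _ _ _ _ HL), (ic_U _ _ _ _ _ _ HF) by auto.
    now rewrite (bf_noslip _ _ _ HB). }
  assert (t0 : tt 0 = RtoC (T 0)).
  { unfold tt. now rewrite (cc_start _ _ _ _ _ _ _ HL), (ic_T _ _ _ _ _ _ HF). }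
  destruct (bf_stream _ _ _ HB yb (Rle_refl _)) as [Uyb Tyb].
  assert (uy : u yb = RtoC 1).
  { unfold u. rewrite (cc_end _ _ _ _ _ _ _ HL), (ic_U _ _ _ _ _ _ HF) by auto. now rewrite Uyb. }
  assert (ty : tt yb = RtoC 1).
  { unfold tt. rewrite (cc_end _ _ _ _ _ _ _ HL), (ic_T _ _ _ _ _ _ HF) by auto. now rewrite Tyb. }
  assert (Pc : forall c, in_disc c0 r c -> seg_cont 0 yb (P c)).
  { intros c Hc. destruct (HP c Hc) as [[H1 _] _]. now apply is_derive_on_cont in H1. }
  assert (dPc : forall c, in_disc c0 r c -> seg_cont 0 yb (dP c)).
  { intros c Hc. destruct (HP c Hc) as [[_ H1] _]. now apply is_derive_on_cont in H1. }
  assert (Pd : forall c, in_disc c0 r c -> seg_derive 0 yb (P c) (fun s => dP c s * w s)%C).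
  { intros c Hc. destruct (HP c Hc) as [[H1 _] _]. exact (is_derive_on_derive _ _ _ _ H1). }
  assert (dPd : forall c, in_disc c0 r c -> seg_derive 0 yb (dP c) (fun s =>
    ((RtoC 2 * u1 s / (u s - c) - t1 s / tt s) * dP c s
     + RtoC alpha ^ 2 * (1 - RtoC M ^ 2 * (u s - c) ^ 2 / tt s) * P c s) * w s)%C).
  { intros c Hc. destruct (HP c Hc) as [[_ H1] _]. exact (is_derive_on_derive _ _ _ _ H1). }
  assert (Py : forall c, in_disc c0 r c -> P c yb = RtoC 1) by (intros c Hc; apply (HP c Hc)).
  assert (dPy : forall c, in_disc c0 r c -> dP c yb = (- gamma c)%C)
    by (intros c Hc; apply (HP c Hc)).
  assert (HTw : T 0 <> 0) by (generalize (bf_Tpos _ _ _ HB 0 (Rle_refl 0)); lra).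
  assert (HdP : dP c0 0 = RtoC 0).
  { revert HD0. unfold D, dispersion. intros <-. unfold Cdiv. ring. }
  assert (Hc0 := in_disc_center c0 r Hr).
  destruct (admittance_lipschitz_slope alpha M yb c0 r u u1 tt t1 w gamma P dP)
    as [r2 [Lh [Bp [Hr2 [Hr2r [HLh [HPn [HG HS]]]]]]]]; auto.
  set (G := admittance alpha u tt P dP) in *.
  set (H := admittance_slope alpha M yb u tt w gamma P dP) in *.
  assert (HP0 : P c0 0 <> RtoC 0) by (apply HPn; now apply in_disc_center).
  assert (HH : H c0 c0 <> RtoC 0).
  { intros E. apply HDc. apply is_C_derive_unique.
    now apply (dispersion_degenerate alpha M yb c0 r u u1 tt t1 w gamma P dP). }
  assert (Hn0 : forall c, in_disc c0 r c -> c <> RtoC 0)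
    by (intros c; now apply (disc_neq_0 yb c0 r u)).
  assert (HKspec : K = (/ H c0 c0)%C).
  { assert (EI : norm_integral alpha yb F L c0 (gamma c0) p0 dp0
        = (- (k * k * wr_total alpha M yb u tt w gamma P dP c0 c0))%C)
      by now apply (norm_integral_wr_total alpha M yb c0 r u tt w gamma P dP).
    assert (EH : H c0 c0 = (Ci * / RtoC alpha * (c0 * (wr_total alpha M yb u tt w gamma P dP c0 c0
        * (/ P c0 0%R * / P c0 0%R))))%C)
      by now apply admittance_slope_diag.
    unfold K, sensitivity. rewrite EI. unfold p0.
    set (W := wr_total alpha M yb u tt w gamma P dP c0 c0) in *.
    assert (HW0 : W <> RtoC 0) by (intros E; apply HH; rewrite EH, E; ring).
    assert (Ha0 : RtoC alpha <> RtoC 0) by (intros E; apply RtoC_inj in E; lra).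
    assert (Hc00 := Hn0 c0 Hc0). assert (Hi := Ci_neq_0).
    rewrite EH.
    (* [field] does not know i^2 = -1. The factor -(i i) = 1 converts the i in the numerator of K
       into the 1/i of 1/H(c0, c0). *)
    transitivity (- (Ci * Ci) * (RtoC alpha * (P c0 0%R * P c0 0%R) / (Ci * c0 * W)))%C.
    - simpl Cpow. field. auto.
    - rewrite Ci_sqr. field. auto. }
  assert (HDf : forall c A, in_disc c0 r2 c ->
    (D c A = - (Ci * RtoC alpha * P c 0%R * c * / RtoC (T 0)) * (G c - A))%C).
  { intros c A Hc. unfold D. apply (dispersion_admittance alpha yb c0 r u tt P dP); auto.
    - apply in_disc_le with r2; [lra | auto].
    - now apply HPn. }
  assert (HNn : forall c, in_disc c0 r2 c ->
    (- (Ci * RtoC alpha * P c 0%R * c * / RtoC (T 0)))%C <> RtoC 0).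
  { intros c Hc E.
    assert (Hne : (Ci * RtoC alpha * P c 0%R * c * / RtoC (T 0))%C <> RtoC 0).
    { repeat apply Cmult_neq_0.
      - exact Ci_neq_0.
      - intros E'. apply RtoC_inj in E'. lra.
      - now apply HPn.
      - apply Hn0. apply in_disc_le with r2; [lra | auto].
      - rewrite <- RtoC_inv by auto. intros E'. apply RtoC_inj in E'. now apply (Rinv_neq_0_compat (T 0)). }
    apply Hne. revert E. generalize (Ci * RtoC alpha * P c 0%R * c * / RtoC (T 0))%C. intros z E.
    replace z with (- - z)%C by ring. rewrite E. ring. }
  assert (HGc0 : G c0 = RtoC 0) by now apply admittance_c0.
  assert (Hr2r' : r2 <= r) by lra.
  split.
  - exact (eigenvalue_branch D _ G H alpha r c0 K r2 Lh Halpha Hr2 Hr2r' HLh HDf HNn HGc0 HG HS HH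
             HKspec).
  - intros W HW.
    exact (eigenvalue_wall_law D _ G H alpha r c0 K r2 Lh Halpha Hr2 Hr2r' HLh HDf HNn HGc0 HG HS HH
             HKspec W HW).
Qed.
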